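(* Let $J\subseteq\Phi^+$ be column closed, $U=U_J$, $V=V_J$, and let $[A]\in\hat V$ be a normal template with $\operatorname{main}[A]=\mathfrak p=\{(i_1,j_1),\ldots,(i_m,j_m)\}$, where $1\le j_1<j_2<\cdots<j_m\le n$. For each main condition $(i_s,j_s)$ let $\mathcal S(j_s)$, $\mathcal M(j_s)$, $\mathcal F^\circ(j_s)=\mathcal S(j_s)\cup\mathcal M(j_s)$ be the index sets attached to it, and for $v\in\mathbb F_q^{\mathcal F^\circ(j_s)}$ let $[A^v]$, $y_v\in U$ and $[A(v)]=y_v.[A^v]$ be as defined in the context. Put $\mathcal Y=\mathcal Y(\mathfrak p,J)$ and regard $\mathbb F_q^{\mathcal S(j_s)}$ as the subspace of $\mathbb F_q^{\mathcal F^\circ(j_s)}$ of vectors with zero coordinates on $\mathcal M(j_s)$. 1) For $\underline v=(v^1,\ldots,v^m)\in\mathbb F_q^{\mathcal S(j_1)}\times\cdots\times\mathbb F_q^{\mathcal S(j_m)}$ define $[A(\underline v)]=[A(v^1)(v^2)\cdots(v^m)]$ (iterating the construction $[A]\mapsto[A(v)]$ successively for columns $j_1,j_2,\ldots,j_m$). Then $[A(\underline v)]$ is a normal template. If $[C]\in\hat V$ is a template with $\operatorname{main}[C]=\mathfrak p$, then $\mathbb C\mathcal O_C^r\cong\mathbb C\mathcal O_A^r$ as $\mathbb CU$-modules if and only if $[C]=[{}_L A(\underline v)]$ for some $L\in\mathbb F_q^{\mathcal Y}$ and some $\underline v\in\mathbb F_q^{\mathcal S(j_1)}\times\cdots\times\mathbb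 F_q^{\mathcal S(j_m)}$. Thus $$\mathcal O_A^{\mathrm{bi}}=\dot\bigcup_{L,\underline v}\ \mathcal O^r_{{}_LA(\underline v)}$$ (disjoint union), where $L$ runs through $\mathbb F_q^{\mathcal Y}$ and $\underline v$ runs through $\mathbb F_q^{\mathcal S(j_1)}\times\cdots\times\mathbb F_q^{\mathcal S(j_m)}$. 2) For $1\le s\le m$ set $$W_s=\{v\in\mathbb F_q^{\mathcal F^\circ(j_s)}\mid v_i=A_{ij_s}\text{ for } i\in\mathcal S(j_s),\ v_i\in\mathbb F_q\text{ arbitrary for } i\in\mathcal M(j_s)\}.$$ Then for $v\in W_s$ one has $[A(v)]=[A]$ and hence $[A^v]=y_v^{-1}.[A(v)]=y_v^{-1}.[A]\in\mathcal O_A^r\cap\mathcal O_A^l$. Moreover, for $\underline v=(v^m,v^{m-1},\ldots,v^1)\in W=W_m\times W_{m-1}\times\cdots\times W_1$ put $y(\underline v)=y_{v^m}^{-1}\cdots y_{v^1}^{-1}$. Then $$\mathcal O_A^r\cap\mathcal O_A^l=\{y(\underline v).[A]\mid \underline v\in W\}.$$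
   Context: General notation. $q$ is a prime power, $n\in\mathbb N$, $E$ is the $n\times n$ identity matrix, $e_{ij}$ are matrix units, $\Phi^+=\{(i,j)\mid 1\le i<j\le n\}$. $J\subseteq\Phi^+$ is column closed if $J=\{(i,j)\mid 1\le i<j\le n,\ j\in I\}$ for some $I\subseteq\{1,\ldots,n\}$. For such $J$, $V=V_J=\{A\in M_n(q)\mid A_{ij}=0\text{ for }(i,j)\notin J\}$ and $U=U_J=\{E+A\mid A\in V_J\}$ (a group under matrix multiplication, which acts on $V$ by left and right multiplication). $\pi_J:M_n(q)\to V_J$ sets all entries at positions outside $J$ to $0$. Fix a nontrivial character $\theta:(\mathbb F_q,+)\to\mathbb C^*$. For $A\in V$ the linear character $[A]$ of $(V,+)$ is $[A](B)=\theta\big(\sum_{(i,j)\in J}A_{ij}B_{ij}\big)$; then $\hat V=\operatorname{Hom}((V,+),\mathbb C^* )=\{[A]\mid A\in V\}$; its elements are called lidempotents. Permutation actions of $U$ on $\hat V$: $([A].u)(B)=[A](Bu^{-1})$, $(u.[A])(B)=[A](u^{-1}B)$; equivalently $[A].u=[\pi_J(Au^{-t})]$, $u.[A]=[\pi_J(u^{-t}A)]$, where $u^{-t}=(u^{-1})^t$. Orbits: $\mathcal O_A^r=[A].U$, $\mathcal O_A^l=U.[A]$, $\mathcal O_A^{\mathrm{bi}}=U.[A].U$. The span $\mathbb C\mathcal O_A^r$ in the space of functions $\mathbb C^V$ is a right $\mathbb CU$-module via the monomial action $\chi g=\chi(g^{-1}-E)\,(\chi.g)$ for $\chi\in\hat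 V$, $g\in U$. Hooks, templates. Row $i$, and each position in row $i$, is called ($J$-)normal if column $i$ does not belong to $J$, i.e. $i\notin I$. For $(i,j)\in J$ the hook arm is ${}^Jh_{ij}^a=\{(i,k)\in J\mid i<k<j\}$ and the hook leg is $h_{ij}^l=\{(k,j)\mid i<k<j\}\subseteq J$. $[A]\in\hat V$ is a template if in $A$, to the left of the highest nonzero entry of each nonzero column, all entries at positions in $J$ are $0$. The positions of these highest nonzero entries are the main conditions; $\mathfrak p=\operatorname{main}[A]$ is their set (they lie in pairwise different rows and columns). A main hook intersection is a position $(j,k)$ such that there are $i<j<k<l$ with $(i,k),(j,l)\in\mathfrak p$. $\operatorname{suppl}(\mathfrak p)$ is the set of positions on the hook legs $h_{ij}^l$, $(i,j)\in\mathfrak p$, which are not main hook intersections (for a template, $A_{st}\ne0$ implies $(s,t)\in\mathfrak p\cup\operatorname{suppl}(\mathfrak p)$). $\mathcal Y(\mathfrak p,J)$ is the set of non-normal positions in $\operatorname{suppl}(\mathfrak p)$; the normal positions of $\operatorname{suppl}(\mathfrak p)$ are the normal (supplementary) conditions. $[A]$ is a normal template if it is a template and nonzero entries of $A$ occur only at main conditions and normal supplementary conditions. For $\mathcal Y=\mathcal Y(\mathfrak p,J)$, $L\in\mathbb F_q^{\mathcal Y}$ and a normal template $[A]$ with main conditions $\mathfrak p$, $[{}_LA]$ is given by $({}_LA)_{ij}=L_{ij}$ for $(i,j)\in\mathcal Y$ and $({}_LA)_{ij}=A_{ij}$ otherwise. Index sets. Let $[A]$ be a normal template, $\mathfrak p=\operatorname{main}[A]$,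 $(a,b)\in\mathfrak p$. Let $\Gamma_{ab}=\{(i,j)\in J\mid a<i<b<j\}$ and $\mathfrak p\cap\Gamma_{ab}=\{(i_1,j_1),\ldots,(i_l,j_l)\}$ (a local numbering), numbered so that exactly the first $r$ of these are in normal rows. Let $\tilde A(a,b)$ be the $(b-1)\times l$ submatrix of $A$ with rows $1,\ldots,b-1$ and columns $j_1,\ldots,j_l$ (it has rank $l$; rows keep their labels). Let $B$ be the matrix of those rows of $\tilde A(a,b)$ which are labelled by normal rows $>a$, and $k=\operatorname{rank}B$. Choose row labels $n_{r+1},\ldots,n_k$ of $B$ such that rows $i_1,\ldots,i_r,n_{r+1},\ldots,n_k$ form a basis of the row space of $B$; let $\tilde B$ be the $k\times l$ matrix of these rows. Renumber $(i_{r+1},j_{r+1}),\ldots,(i_l,j_l)$ such that columns $j_1,\ldots,j_k$ of $\tilde B$ are linearly independent. Put $\mathcal S=\mathcal S(b)=\{n_{r+1},\ldots,n_k\}$, $\mathcal M=\mathcal M(b)=\{i_{k+1},\ldots,i_l\}$, $\mathcal F^\circ=\mathcal F^\circ(b)=\mathcal S\cup\mathcal M$, $\mathcal F=\{i_1,\ldots,i_r\}\cup\mathcal F^\circ$. Rows $i\in\mathcal F$ of $\tilde A(a,b)$ form a basis of its row space. For a finite set $\mathcal T$, $\mathbb F_q^{\mathcal T}$ denotes the space of vectors indexed by $\mathcal T$. These choices depend only on $\tilde A(a,b)$, i.e. only on entries of $A$ in columns to the right of $b$. The lidempotents $[A^v]$, $[A(v)]$. For $v=(\beta_i)\in\mathbb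 F_q^{\mathcal F^\circ}$, $[A^v]\in\mathcal O_A^r$ is the unique lidempotent which agrees with $[A]$ at all positions not on $h_{ab}^l$ and satisfies $A^v_{ib}=0$ for $i\in\{i_1,\ldots,i_r\}$, $A^v_{ib}=\beta_i$ for $i\in\mathcal F^\circ$; for $a<t<b$, $t\notin\mathcal F$, if row $t$ of $\tilde A(a,b)$ is $\sum_{h\in\mathcal F}\lambda_h\,(\text{row }h)$ then $A^v_{tb}=A_{tb}+\sum_{h\in\mathcal F}\lambda_h(A^v_{hb}-A_{hb})$. There is an element $y_v\in U$ such that $y_v.[A^v]$ is a normal template; fix such a $y_v$ and write $[A(v)]=y_v.[A^v]$. In the iterated construction $[A(v^1)(v^2)\cdots(v^m)]$ the step for column $j_s$ is applied to the normal template $[A(v^1)\cdots(v^{s-1})]$ with $(a,b)=(i_s,j_s)$; since the previous steps do not change the columns $\geq j_s$, the same sets $\mathcal S(j_s),\mathcal M(j_s)$ are used. *)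

(* Defs.v *)
From HB Require Import structures.
From mathcomp Require Import all_boot all_order all_algebra.
From mathcomp Require Import reals.
From mathcomp Require Import complex.

Set Implicit Arguments.
Unset Strict Implicit.
Unset Printing Implicit Defensive.

Import Order.TTheory GRing.Theory Num.Theory.
Local Open Scope ring_scope.

Section Patterns.

Variables (F : finFieldType) (n : nat).

Notation pos := ('I_n * 'I_n)%type.
Implicit Types (A B X C : 'M[F]_n) (J p : {set pos}) (a b : 'I_n).

Definition column_closed J : Prop :=
  exists I : {set 'I_n}, J = [set x : pos | (x.1 < x.2)%N && (x.2 \in I)].

Definition VJ J : {set 'M[F]_n} :=
  [set A : 'M[F]_n | [forall x : pos, (x \notin J) ==> (A x.1 x.2 == 0)]].

Definition UJ J : {set 'M[F]_n} := [set u : 'M[F]_n | u - 1%:M \in VJ J].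

Definition piJ J A : 'M[F]_n :=
  \matrix_(i, j) (if (i, j) \in J then A i j else 0).

(* F^T for a set T of labels drawn from a finite type K: vectors indexed by all
   of K and supported in T, so F^S is a subset of F^T whenever S \subset T. *)
Definition vecs (K : finType) (T : {set K}) : {set {ffun K -> F}} :=
  [set v : {ffun K -> F} | [forall i, (i \notin T) ==> (v i == 0)]].

(* "Column i does not belong to J".  If J = {(i, j) | i < j, j \in I}, this is
   i \notin I, except that row 0 always counts as normal; row 0 never lies
   strictly below another row, so it plays no role below. *)
Definition normal_row J (i : 'I_n) : bool := [forall k, (k, i) \notin J].

Definition hook_leg (i j : 'I_n) : {set pos} :=
  [set x : pos | [&& (i < x.1)%N, (x.1 < j)%N & x.2 == j]].

Definition mainc A : {set pos} :=
  [set x : pos | (A x.1 x.2 != 0) &&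
    [forall i : 'I_n, (i < x.1)%N ==> (A i x.2 == 0)]].

Definition template J A : bool :=
  (A \in VJ J) &&
  [forall x in mainc A, forall k : 'I_n,
     (k < x.2)%N && ((x.1, k) \in J) ==> (A x.1 k == 0)].

Definition main_hook_intersection p (x : pos) : bool :=
  [exists i : 'I_n, exists l : 'I_n,
     [&& (i < x.1)%N, (x.1 < x.2)%N, (x.2 < l)%N,
         (i, x.2) \in p & (x.1, l) \in p]].

Definition suppl p : {set pos} :=
  [set x : pos | [exists c in p, x \in hook_leg c.1 c.2]
                 && ~~ main_hook_intersection p x].

Definition YpJ p J : {set pos} := [set x in suppl p | ~~ normal_row J x.1].

Definition normal_template J A : bool :=
  template J A &&
  [forall x : pos, (A x.1 x.2 != 0) ==>
     ((x \in mainc A) || (x \in suppl (mainc A)) && normal_row J x.1)].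

Definition put (Y : {set pos}) (L : {ffun pos -> F}) A : 'M[F]_n :=
  \matrix_(i, j) (if (i, j) \in Y then L (i, j) else A i j).

Definition main_Gamma J A a b : {set pos} :=
  [set x in mainc A | [&& x \in J, (a < x.1)%N, (x.1 < b)%N & (b < x.2)%N]].

(* {j_1, .., j_l}: the columns of \tilde A(a, b). *)
Definition tcols J A a b : {set 'I_n} := [set x.2 | x in main_Gamma J A a b].

(* {i_1, .., i_r} and {i_(r+1), .., i_l}. *)
Definition nrows J A a b : {set 'I_n} :=
  [set x.1 | x in main_Gamma J A a b & normal_row J x.1].
Definition nnrows J A a b : {set 'I_n} :=
  [set x.1 | x in main_Gamma J A a b & ~~ normal_row J x.1].

Definition Brows J a b : {set 'I_n} :=
  [set t : 'I_n | [&& (a < t)%N, (t < b)%N & normal_row J t]].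

Definition submat (R D : {set 'I_n}) A : 'M[F]_(#|R|, #|D|) :=
  mxsub enum_val enum_val A.

(* With B the rows of \tilde A(a, b) labelled by Brows J a b and k its rank,
   S = {n_(r+1), .., n_k} and M = {i_(k+1), .., i_l} form an admissible choice;
   the columns j_1, .., j_k are those whose main condition is in a row not
   in M. *)
Definition index_sets J A a b (S M : {set 'I_n}) : Prop :=
  let: D := tcols J A a b in
  let: R := nrows J A a b in
  let: D1 := [set x.2 | x in main_Gamma J A a b & x.1 \notin M] in
  let: B := submat (Brows J a b) D A in
  [/\ S \subset Brows J a b, [disjoint R & S] & M \subset nnrows J A a b] /\
  [/\ row_free (submat (R :|: S) D A),
      (submat (R :|: S) D A :=: B)%MS,
      #|D1| = \rank B
    & \rank (submat (R :|: S) D1 A) = #|D1| ].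

Lemma piJ_VJ J A : piJ J A \in VJ J.
Proof.
by rewrite inE; apply/forallP => -[i j]; apply/implyP => /negPf H; rewrite mxE H.
Qed.

Lemma piJ_id J A : A \in VJ J -> piJ J A = A.
Proof.
rewrite inE => /forallP H; apply/matrixP => i j; rewrite mxE.
by case: ifPn => // /(implyP (H (i, j))) /eqP ->.
Qed.

Lemma UJ_inv J u : column_closed J -> u \in UJ J ->
  (u \in unitmx) && (invmx u \in UJ J).
Proof.
case=> I JE; rewrite !inE => /forallP uV.
have uE (i j : 'I_n) : ~~ ((i < j)%N && (j \in I)) -> u i j = (i == j)%:R.
  move=> Hij; have /implyP := uV (i, j); rewrite JE inE /= => /(_ Hij).
  by rewrite !mxE subr_eq0 => /eqP ->.
have uu : u \in unitmx.
  rewrite unitmxE -det_tr det_trig.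
    by rewrite big1 ?unitr1 // => i _; rewrite mxE uE ?ltnn ?eqxx.
  apply/is_trig_mxP => i j ij; rewrite mxE uE; last by rewrite ltnNge ltnW.
  by rewrite -val_eqE gtn_eqF.
rewrite uu /=; set w := invmx u.
have wE i j : w i j = (i == j)%:R - \sum_k w i k * (u k j - (k == j)%:R).
  rewrite -[X in _ = X - _](_ : (w *m u) i j = _); last first.
    by rewrite mulVmx // mxE.
  rewrite mxE -sumrB (bigD1 j) //= big1 => [|k kj].
    by rewrite eqxx mulrBr mulr1 addr0 opprB addrCA subrr addr0.
  by rewrite (negPf kj) subr0 subrr.
have wlow : forall k (i j : 'I_n), (j < k)%N -> (j <= i)%N -> w i j = (i == j)%:R.
  elim=> // k IH i j; rewrite ltnS => jk ji; rewrite wE big1 ?subr0 // => h _.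
  case: (ltnP h j) => hj; last by rewrite uE ?subrr ?mulr0 // ltnNge hj.
  rewrite IH ?(leq_trans hj) // ?(ltnW (leq_trans hj ji)) //.
  by rewrite -val_eqE gtn_eqF ?mul0r // (leq_trans hj ji).
apply/forallP => -[i j]; apply/implyP; rewrite JE inE /= => Hij.
rewrite !mxE subr_eq0; apply/eqP; case: (leqP j i) Hij => [ji _|_ /= jI].
  exact: (wlow j.+1).
rewrite wE big1 ?subr0 // => k _; rewrite uE ?subrr ?mulr0 //.
by rewrite (negPf jI) andbF.
Qed.

Lemma VJ0 J A i j : A \in VJ J -> (i, j) \notin J -> A i j = 0.
Proof. by rewrite inE => /forallP /(_ (i, j)) /implyP H /H /eqP. Qed.

Lemma VJD J A B : A \in VJ J -> B \in VJ J -> A + B \in VJ J.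
Proof.
move=> AV BV; rewrite inE; apply/forallP => -[i j]; apply/implyP => ij.
by rewrite mxE (VJ0 AV) // (VJ0 BV) // addr0.
Qed.

Lemma VJM J A B : column_closed J -> A \in VJ J -> B \in VJ J -> A *m B \in VJ J.
Proof.
case=> I JE AV BV; rewrite inE; apply/forallP => -[i j]; apply/implyP => ij.
rewrite mxE big1 // => k _.
have [ik|ik] := boolP ((i, k) \in J); last by rewrite (VJ0 AV) ?mul0r.
rewrite (VJ0 BV) ?mulr0 //; apply: contra ij; move: ik; rewrite !JE !inE /=.
by move=> /andP[ik _] /andP[kj ->]; rewrite (ltn_trans ik kj).
Qed.

Lemma subinv_VJ J u : column_closed J -> u \in UJ J -> invmx u - 1%:M \in VJ J.
Proof. by move=> Jc /(UJ_inv Jc) /andP[_]; rewrite inE. Qed.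

Lemma mulVJ_inv J A u : column_closed J -> A \in VJ J -> u \in UJ J ->
  A *m invmx u \in VJ J.
Proof.
move=> Jc AV /(subinv_VJ Jc) uV; rewrite -[invmx u](subrK 1%:M) mulmxDr mulmx1.
exact: VJD (VJM Jc AV uV) AV.
Qed.

Lemma mulinv_VJ J A u : column_closed J -> A \in VJ J -> u \in UJ J ->
  invmx u *m A \in VJ J.
Proof.
move=> Jc AV /(subinv_VJ Jc) uV; rewrite -[invmx u](subrK 1%:M) mulmxDl mul1mx.
exact: VJD (VJM Jc uV AV) AV.
Qed.

Definition Vtype J : Type := {B : 'M[F]_n | B \in VJ J}.
HB.instance Definition _ J := Finite.on (Vtype J).

Definition toV J A : Vtype J := exist _ (piJ J A) (piJ_VJ J A).

Variables (R : realType) (theta : F -> R[i]).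

Definition nontrivial_character : Prop :=
  [/\ theta 0 = 1, {morph theta : x y / x + y >-> x * y}
    & exists x, theta x != 1].

Definition CV J := {ffun Vtype J -> R[i]^o}.

(* The lidempotent [A], for A in V. *)
Definition lid J A : CV J :=
  [ffun B : Vtype J => theta (\sum_(x in J) A x.1 x.2 * val B x.1 x.2) : R[i]^o].

(* For J column closed, B in V and u in U, the matrices B u^-1, u^-1 B and
   B u^-1 + u^-1 - E are in V (lemmas mulVJ_inv, mulinv_VJ, subinv_VJ), and
   toV leaves them unchanged. *)
Definition ract J (u : 'M[F]_n) (chi : CV J) : CV J :=
  [ffun B : Vtype J => chi (toV J (val B *m invmx u))].
Definition lact J (u : 'M[F]_n) (chi : CV J) : CV J :=
  [ffun B : Vtype J => chi (toV J (invmx u *m val B))].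

(* Linear extension to C^V of the monomial action
   chi g = chi(g^-1 - E) (chi.g), see lemma mact_lid. *)
Definition mact J (g : 'M[F]_n) (f : CV J) : CV J :=
  [ffun B : Vtype J => f (toV J (val B *m invmx g + invmx g - 1%:M))].

(* The matrices of u.[A] and [A].u, see lemmas lact_lid and ract_lid. *)
Definition lactm J (u A : 'M[F]_n) : 'M[F]_n := piJ J ((invmx u)^T *m A).
Definition ractm J (u A : 'M[F]_n) : 'M[F]_n := piJ J (A *m (invmx u)^T).

Lemma pairing_tr J A B : (A \in VJ J) || (B \in VJ J) ->
  \sum_(x in J) A x.1 x.2 * B x.1 x.2 = \tr (A^T *m B).
Proof.
move=> AB; transitivity (\sum_(x : pos) A x.1 x.2 * B x.1 x.2).
  rewrite big_mkcond; apply: eq_bigr => -[i j] _ /=; case: ifPn => // ij.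
  by case/orP: AB => H; rewrite (VJ0 H) ?mul0r ?mulr0.
rewrite -(pair_bigA _ (fun i j => A i j * B i j)) exchange_big /=.
by apply: eq_bigr => j _; rewrite mxE; apply: eq_bigr => i _; rewrite mxE.
Qed.

Lemma pairing_piJ J A B :
  \sum_(x in J) piJ J A x.1 x.2 * B x.1 x.2 = \sum_(x in J) A x.1 x.2 * B x.1 x.2.
Proof. by apply: eq_bigr => -[i j] ij; rewrite mxE ij. Qed.

Lemma lact_lid J u A : column_closed J -> A \in VJ J -> u \in UJ J ->
  lact u (lid J A) = lid J (lactm J u A).
Proof.
move=> Jc AV uU; apply/ffunP => -[B BV]; rewrite !ffunE /=; congr theta.
rewrite piJ_id ?mulinv_VJ // pairing_piJ !pairing_tr ?AV ?BV ?orbT //.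
by rewrite trmx_mul trmxK mulmxA.
Qed.

Lemma ract_lid J u A : column_closed J -> A \in VJ J -> u \in UJ J ->
  ract u (lid J A) = lid J (ractm J u A).
Proof.
move=> Jc AV uU; apply/ffunP => -[B BV]; rewrite !ffunE /=; congr theta.
rewrite piJ_id ?mulVJ_inv // pairing_piJ !pairing_tr ?AV ?BV ?orbT //.
by rewrite trmx_mul trmxK mulmxA mxtrace_mulC mulmxA.
Qed.

Lemma mact_lid J g A : column_closed J -> g \in UJ J -> nontrivial_character ->
  mact g (lid J A) = lid J A (toV J (invmx g - 1%:M)) *: ract g (lid J A).
Proof.
move=> Jc gU [_ thD _]; apply/ffunP => -[B BV]; rewrite !ffunE /=.
have gV := subinv_VJ Jc gU; have BgV := mulVJ_inv Jc BV gU.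
rewrite -addrA !piJ_id //; last exact: VJD.
rewrite /GRing.scale /= -thD; congr theta; rewrite -big_split /=.
apply: eq_bigr => x _; rewrite -mulrDr; congr (_ * _); rewrite addrC.
by rewrite [LHS]mxE.
Qed.

Definition orbr J A : seq (CV J) := [seq ract u (lid J A) | u in UJ J].
Definition orbl J A : seq (CV J) := [seq lact u (lid J A) | u in UJ J].
Definition orbbi J A : seq (CV J) :=
  [seq lact u (ract w (lid J A)) | u <- enum (UJ J), w <- enum (UJ J)].

Definition CU_iso J (W1 W2 : {vspace CV J}) : Prop :=
  exists phi : 'Hom(CV J, CV J),
    [/\ (phi @: W1)%VS = W2, {in W1 &, injective phi}
      & {in W1 & UJ J, forall f g, phi (mact g f) = mact g (phi f)}].

Definition is_Av J A a b (S M : {set 'I_n}) (v : {ffun 'I_n -> F}) X : bool :=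
  let: R := nrows J A a b in
  let: FF := R :|: S :|: M in
  [&& X \in VJ J, lid J X \in orbr J A,
      [forall x : pos, (x \notin hook_leg a b) ==> (X x.1 x.2 == A x.1 x.2)],
      [forall i in R, X i b == 0],
      [forall i in S :|: M, X i b == v i]
    & [forall t : 'I_n, [&& (a < t)%N, (t < b)%N & t \notin FF] ==>
       [forall lam : {ffun 'I_n -> F},
          [forall c in tcols J A a b, A t c == \sum_(h in FF) lam h * A h c] ==>
          (X t b == A t b + \sum_(h in FF) lam h * (X h b - A h b))]]].

(* Intended: the unique X with is_Av; A is a dummy value for the case that
   there is none. *)
Definition Av J A a b (S M : {set 'I_n}) (v : {ffun 'I_n -> F}) : 'M[F]_n :=
  odflt A [pick X | is_Av J A a b S M v X].

Section Iteration.

(* (ii s, jj s) are the main conditions in the order of their columns, SS s and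
   MM s their index sets, and y A s v is the element y_v used at column jj s of
   the template [A]. *)
Variables (J : {set pos}) (m : nat) (ii jj : 'I_m -> 'I_n).
Variables (SS MM : 'I_m -> {set 'I_n}).
Variable y : 'M[F]_n -> 'I_m -> {ffun 'I_n -> F} -> 'M[F]_n.

Definition Avs A (s : 'I_m) (v : {ffun 'I_n -> F}) : 'M[F]_n :=
  Av J A (ii s) (jj s) (SS s) (MM s) v.

Definition normalizes A (s : 'I_m) (v : {ffun 'I_n -> F}) (u : 'M[F]_n) : bool :=
  (u \in UJ J) && normal_template J (lactm J u (Avs A s v)).

(* No existence is assumed here: y A s v has the required property as soon as
   some element has it. *)
Definition y_choice : Prop :=
  forall A s v u, normalizes A s v u -> normalizes A s v (y A s v).

Definition Astep A (s : 'I_m) (v : {ffun 'I_n -> F}) : 'M[F]_n :=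
  lactm J (y A s v) (Avs A s v).

Definition Aiter A (v : {ffun 'I_m -> {ffun 'I_n -> F}}) : 'M[F]_n :=
  foldl (fun X s => Astep X s (v s)) A (enum 'I_m).

Definition Ws A (s : 'I_m) : {set {ffun 'I_n -> F}} :=
  [set v : {ffun 'I_n -> F} in vecs (SS s :|: MM s) |
     [forall i in SS s, v i == A i (jj s)]].

Definition yprod A (v : {ffun 'I_m -> {ffun 'I_n -> F}}) : 'M[F]_n :=
  \big[mulmx/1%:M]_(s <- rev (enum 'I_m)) invmx (y A s (v s)).

End Iteration.

End Patterns.

(* Main.v *)
(* The left action adds higher rows to non-normal lower rows, and the rows of the
   main conditions form a triangular system.  Hence, as soon as the main
   conditions of X lie in different rows, the left orbit of X consists of all
   matrices agreeing with X in the normal rows and at and above the main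
   conditions.  The right action changes each column independently by
   combinations of the columns to its right, and triangularity shows that a right
   orbit contains at most one template with given main conditions.  For a
   template C with the main conditions of A this gives: [C] lies in the
   biorbit of [A] iff C and A agree at the main conditions and, for each main
   condition (a, b), the normal rows of the b-th columns of C and A differ by a
   combination of the columns of \tilde A(a, b).  Such a difference is determined
   by its entries in the rows of S(b), as it vanishes in the normal rows of main
   conditions to the right of b, and any entries there are possible; the
   non-normal entries of C are arbitrary on Y.  Also A(v) is A with only the normal
   part of one column modified, whatever y_v is, so the columns can be treated one
   at a time.

   For the module statement: left multiplication by U in the group algebra
   induces isomorphisms between the modules of the right orbits within a biorbit.
   Conversely, writing the value at 0 of a homomorphism phi as a functional on
   C^V shows that phi [C] lies in the span of the left orbit of [C], which
   meets the span of the right orbit of [A] in 0 unless the two orbits meet. *)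

Require Import Defs.
From HB Require Import structures.
From mathcomp Require Import all_boot all_order all_algebra.
From mathcomp Require Import reals.
From mathcomp Require Import complex.

Set Implicit Arguments.
Unset Strict Implicit.
Unset Printing Implicit Defensive.

Import Order.TTheory GRing.Theory Num.Theory.
Local Open Scope ring_scope.

(** * Square linear systems indexed by finite sets *)

Section LinearSystems.

Variable F : fieldType.

(** A square matrix with trivial left kernel is both row free and row full, so the system and its
    transpose are solvable for every right-hand side. Unknowns are functions on the index types,
    which spares later arguments any enumeration. *)
Lemma square_system (T1 T2 : finType) (q : {set T1}) (r : {set T2})
    (M : T1 -> T2 -> F) :
  #|q| = #|r| ->
  (forall w : T2 -> F, (forall x, x \in q -> \sum_(y in r) w y * M x y = 0) ->
     forall y, y \in r -> w y = 0) ->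
  (forall e : T1 -> F, exists w : T2 -> F,
     forall x, x \in q -> \sum_(y in r) w y * M x y = e x) /\
  (forall e : T2 -> F, exists w : T1 -> F,
     forall y, y \in r -> \sum_(x in q) w x * M x y = e y).
Proof.
move=> qr Minj.
pose N : 'M[F]_(#|r|, #|q|) := \matrix_(j, i) M (enum_val i) (enum_val j).
have ext (T : finType) (s : {set T}) (v : 'rV[F]_#|s|) :
    exists w : T -> F, forall i, v 0 i = w (enum_val i).
  exists (fun x => if [pick i | enum_val i == x] is Some i then v 0 i else 0).
  by move=> i; case: pickP => [j /eqP/enum_val_inj->|/(_ i)/eqP].
have Nfree : row_free N.
  apply: inj_row_free => v vN; have [w vw] := ext _ _ v.
  apply/rowP => j; rewrite mxE vw; apply: Minj (enum_valP j) => x xq.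
  rewrite big_enum_val /=; move/rowP/(_ (enum_rank_in xq x)): vN; rewrite !mxE.
  by move=> {2}<-; apply: eq_bigr => k _; rewrite vw mxE enum_rankK_in.
have Nfull : row_full N.
  by rewrite /row_full (eqP Nfree) qr.
split=> e.
  have [w ww] := ext _ _ ((\row_i e (enum_val i)) *m pinvmx N).
  exists w => x xq; rewrite big_enum_val /=.
  have := mulmxKpV (submx_full (\row_i e (enum_val i)) Nfull).
  move/rowP/(_ (enum_rank_in xq x)); rewrite !mxE enum_rankK_in // => <-.
  by apply: eq_bigr => k _; rewrite ww !mxE enum_rankK_in.
have [w ww] := ext _ _ ((pinvmx N *m \col_j e (enum_val j))^T).
exists w => y yr; rewrite big_enum_val /=.
have : N *m (pinvmx N *m \col_j e (enum_val j)) = \col_j e (enum_val j).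
  by rewrite mulmxA mulmxVp ?mul1mx.
move/colP/(_ (enum_rank_in yr y)); rewrite !mxE enum_rankK_in // => <-.
by apply: eq_bigr => k _; rewrite -ww !mxE mulrC enum_rankK_in.
Qed.

End LinearSystems.

(** * Main conditions and the triangular systems they carry *)

Section Mains.

Variables (F : finFieldType) (n : nat).
Implicit Types (a b c i : 'I_n) (X Z C : 'M[F]_n) (p q : {set 'I_n * 'I_n}).

Lemma mainc_neq0 X i b : (i, b) \in mainc X -> X i b != 0.
Proof. by rewrite inE => /andP[]. Qed.

Lemma mainc_above X a b i : (a, b) \in mainc X -> (i < a)%N -> X i b = 0.
Proof. by rewrite inE => /andP[_ /forallP/(_ i)/implyP H] /H/eqP. Qed.

Lemma mainc_le X i a b : (a, b) \in mainc X -> X i b != 0 -> (a <= i)%N.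
Proof. by move=> ab; apply: contraR; rewrite -ltnNge => /(mainc_above ab) ->. Qed.

Lemma mainc_ex X i b : X i b != 0 -> exists2 a, (a, b) \in mainc X & (a <= i)%N.
Proof.
move=> Xib; case: (arg_minnP (P := fun k => X k b != 0) val Xib) => a Xab amin.
exists a; last exact: amin.
rewrite inE /= Xab; apply/forallP => k; apply/implyP; rewrite ltnNge.
by apply: contraR => /amin.
Qed.

Lemma mainc_col X a a' b : (a, b) \in mainc X -> (a', b) \in mainc X -> a = a'.
Proof.
move=> ab a'b; apply/val_inj/eqP; rewrite eqn_leq.
by rewrite (mainc_le ab (mainc_neq0 a'b)) (mainc_le a'b (mainc_neq0 ab)).
Qed.

Lemma eq_mainc X Z :
  (forall i b, Z i b != 0 -> exists2 a, (a, b) \in mainc X & (a <= i)%N) ->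
  (forall a b, (a, b) \in mainc X -> Z a b != 0) -> mainc Z = mainc X.
Proof.
move=> Zle Zne; apply/setP => -[a b]; apply/idP/idP => [Zab|Xab].
  have [a' Xa'b le] := Zle _ _ (mainc_neq0 Zab).
  suff -> : a = a' by [].
  apply/val_inj/eqP; rewrite eqn_leq le andbT.
  exact: mainc_le Zab (Zne _ _ Xa'b).
rewrite inE /= Zne //=; apply/forallP => i; apply/implyP; rewrite ltnNge.
by apply: contraR => /Zle[a' Xa'b]; rewrite (mainc_col Xab Xa'b).
Qed.

(** Non-attacking rooks: only rows need a condition, since [mainc_col] gives at most one main
    condition per column for every matrix. *)
Definition rook p : Prop :=
  forall a b c, (a, b) \in p -> (a, c) \in p -> b = c.

(** Above its main condition a column vanishes, so the equation in row [x.1] involves only those [y]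
    whose row is at or above [x.1]. The rook condition leaves [x] alone in its own row, and
    induction on the row gives [w x = 0]. *)
Lemma triangular_zero X q (w : 'I_n * 'I_n -> F) :
  rook (mainc X) -> q \subset mainc X ->
  (forall x, x \in q -> \sum_(y in q) w y * X x.1 y.2 = 0) ->
  forall x, x \in q -> w x = 0.
Proof.
move=> rX /subsetP qX wX.
suff H k x : x \in q -> (x.1 < k)%N -> w x = 0 by move=> x /H; apply.
elim: k x => // k IH x xq; rewrite ltnS => xk.
have := wX x xq; rewrite (bigD1 x) //= big1 ?addr0 => [/eqP|y /andP[yq yx]].
  by rewrite mulf_eq0 => /orP[/eqP//|]; case: (x) (qX _ xq) => a b /mainc_neq0/negPf->.
have [->|Xxy] := eqVneq (X x.1 y.2) 0; first by rewrite mulr0.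
have ym : (y.1, y.2) \in mainc X by case: (y) (qX _ yq).
rewrite IH ?mul0r //; apply: leq_trans xk.
rewrite ltn_neqAle (mainc_le ym Xxy) andbT; apply: contraNN yx => /eqP/val_inj e.
have xm : (x.1, x.2) \in mainc X by case: (x) (qX _ xq).
by move: ym; rewrite e => /(rX _ _ _ xm); move: e; case: (x) (y) => ? ? [? ?] /= -> ->.
Qed.

Lemma triangular_system X q : rook (mainc X) -> q \subset mainc X ->
  (forall e : 'I_n * 'I_n -> F, exists w : 'I_n * 'I_n -> F,
     forall x, x \in q -> \sum_(y in q) w y * X x.1 y.2 = e x) /\
  (forall e : 'I_n * 'I_n -> F, exists w : 'I_n * 'I_n -> F,
     forall y, y \in q -> \sum_(x in q) w x * X x.1 y.2 = e y).
Proof.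
move=> rX qX; apply: (@square_system _ _ _ q q (fun x y => X x.1 y.2)) => // w.
exact: triangular_zero.
Qed.

(** Columns without a main condition are zero, so combinations of columns may be indexed by main
    conditions instead; this is the indexing of the triangular systems. *)
Lemma sum_mainc X (P : pred 'I_n) (w : 'I_n -> F) i :
  \sum_(c | P c) w c * X i c =
  \sum_(y in mainc X | P y.2) w y.2 * X i y.2.
Proof.
rewrite (bigID (fun c => [exists a, (a, c) \in mainc X])) /= addrC big1 ?add0r.
  rewrite [RHS](partition_big (fun y : 'I_n * 'I_n => y.2)
    (fun c => P c && [exists a, (a, c) \in mainc X])) /=.
    apply: eq_bigr => c /andP[Pc /existsP[a ac]]; rewrite (big_pred1 (a, c)) //.
    move=> [a' c'] /=; rewrite xpair_eqE.
    apply/andP/andP => [[/andP[a'c' _] /eqP e]|[/eqP-> /eqP->]]; last by rewrite ac eqxx Pc.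
    by rewrite -e (mainc_col a'c' (_ : (a, c') \in _)) ?eqxx // e.
  by case=> a c /andP[/= ac ->]; apply/existsP; exists a.
move=> c /andP[_ /existsPn c0]; have [->|/mainc_ex[a ac]] := eqVneq (X i c) 0.
  by rewrite mulr0.
by have := c0 a; rewrite ac.
Qed.

End Mains.

(** * Entrywise description of left and right orbits *)

Section Orbits.

Variables (F : finFieldType) (n : nat) (J : {set 'I_n * 'I_n}).
Hypothesis J_cc : column_closed J.
Implicit Types (a b c i k t : 'I_n) (X Z C u : 'M[F]_n).
Implicit Types (p q : {set 'I_n * 'I_n}).

Lemma J_lt i b : (i, b) \in J -> (i < b)%N.
Proof. by case: J_cc => I ->; rewrite inE => /andP[]. Qed.

Lemma J_above i b k : (i, b) \in J -> (k < b)%N -> (k, b) \in J.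
Proof. by case: J_cc => I ->; rewrite !inE /= => /andP[_ ->] ->. Qed.

Lemma nonnormal_J a t : ~~ normal_row J t -> (a < t)%N -> (a, t) \in J.
Proof. by case/forallPn => k; rewrite negbK => /J_above; apply. Qed.

Lemma normal_notJ k t : normal_row J t -> (k, t) \notin J.
Proof. by move/forallP. Qed.

Lemma VJ_neq0 X i b : X \in VJ F J -> X i b != 0 -> (i, b) \in J.
Proof. by move=> XV; apply: contraR => /(VJ0 XV) ->. Qed.

Lemma VJP X : reflect (forall i b, (i, b) \notin J -> X i b = 0) (X \in VJ F J).
Proof.
apply: (iffP idP) => [XV i b|H]; first exact: VJ0.
by rewrite inE; apply/forallP => -[i b]; apply/implyP => /H /= ->.
Qed.

Lemma UJP u : reflect (forall i b, (i, b) \notin J -> u i b = (i == b)%:R)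
  (u \in UJ F J).
Proof.
rewrite inE; apply: (iffP (VJP _)) => H i b /H; rewrite !mxE.
  by move/eqP; rewrite subr_eq0 => /eqP.
by move=> ->; rewrite subrr.
Qed.

Lemma UJ1 : 1%:M \in UJ F J.
Proof. by apply/UJP => i b _; rewrite mxE. Qed.

Lemma UJ_unit u : u \in UJ F J -> u \in unitmx.
Proof. by case/(UJ_inv J_cc)/andP. Qed.

Lemma UJV u : u \in UJ F J -> invmx u \in UJ F J.
Proof. by case/(UJ_inv J_cc)/andP. Qed.

Lemma mulVJ_UJ X u : X \in VJ F J -> u \in UJ F J -> X *m u \in VJ F J.
Proof. by move=> XV /UJV uU; rewrite -[u]invmxK; apply: mulVJ_inv. Qed.

Lemma mulUJ_VJ X u : X \in VJ F J -> u \in UJ F J -> u *m X \in VJ F J.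
Proof. by move=> XV /UJV uU; rewrite -[u]invmxK; apply: mulinv_VJ. Qed.

Lemma UJM u w : u \in UJ F J -> w \in UJ F J -> u *m w \in UJ F J.
Proof.
move=> uU wU; rewrite inE -[u](subrK 1%:M) mulmxDl mul1mx -addrA.
by apply: VJD; [apply: mulVJ_UJ; rewrite // inE in uU|rewrite inE in wU].
Qed.

Lemma invmxM u w : u \in UJ F J -> w \in UJ F J ->
  invmx (u *m w) = invmx w *m invmx u.
Proof.
move=> uU wU; have uw := UJ_unit (UJM uU wU).
apply: (can_inj (mulKmx uw)); rewrite mulmxV // mulmxA -(mulmxA u).
by rewrite mulmxV ?UJ_unit // mulmx1 mulmxV ?UJ_unit.
Qed.

(** Orbit relations between matrices rather than characters, so that orbits can be compared entry by
    entry; [lid_orbr] and [lid_orbl] translate back. *)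
Definition rrel X Z : Prop := exists2 u, u \in UJ F J & Z = ractm J u X.
Definition lrel X Z : Prop := exists2 u, u \in UJ F J & Z = lactm J u X.

(** Column [b] of [X *m (invmx u)^T] combines columns of [X] with row [b] of [invmx u] as
    coefficients. Different columns use different rows, so the coefficients may be chosen
    independently. A coefficient at [(b, c)] with [b < c] outside [J] is irrelevant, because column
    [c] of [X] is then zero. *)
Lemma rrelP X Z : X \in VJ F J ->
  rrel X Z <-> Z \in VJ F J /\ forall b, exists w : 'I_n * 'I_n -> F,
    forall i, (i, b) \in J ->
    Z i b = X i b + \sum_(y in mainc X | (b < y.2)%N) w y * X i y.2.
Proof.
move=> XV; split=> [[u uU ->]|[ZV /fin_all_exists[w Zw]]].
  split=> [|b]; first exact: piJ_VJ.
  exists (fun y => invmx u b y.2) => i ib; rewrite mxE ib mxE.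
  have /UJP uV := UJV uU; have bJ c : (c <= b)%N -> (b, c) \notin J.
    by rewrite leqNgt; apply: contra => /J_lt.
  rewrite -(sum_mainc X (fun c => (b < c)%N) (fun c => invmx u b c)).
  rewrite (bigD1 b) //= mxE uV ?bJ // eqxx mulr1; congr (_ + _).
  rewrite big_mkcond [RHS]big_mkcond; apply: eq_bigr => c _ /=.
  rewrite mxE mulrC; case: ltngtP => [bc|cb|/val_inj->]; last by rewrite eqxx.
    by rewrite -val_eqE gtn_eqF.
  by rewrite -val_eqE ltn_eqF //= uV ?bJ ?(ltnW cb) // -val_eqE gtn_eqF ?mul0r.
(* The default 0 is harmless: a column without a main condition is zero. *)
pose w' b c := if [pick a | (a, c) \in mainc X] is Some a then w b (a, c) else 0.
pose v : 'M[F]_n := \matrix_(b, c) (if (b, c) \in J then w' b c else (b == c)%:R).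
have vU : v \in UJ F J by apply/UJP => b c /negPf bc; rewrite mxE bc.
(* The action involves the inverse of the group element, so the matrix of coefficients enters as an
   inverse. *)
exists (invmx v); first exact: UJV.
apply/matrixP => i b; rewrite mxE; case: ifPn => [ib|]; last exact: VJ0.
rewrite (Zw b i ib) invmxK mxE (bigD1 b) //= !mxE.
rewrite [(b, b) \in J](negbTE _); last by apply/negP => /J_lt; rewrite ltnn.
rewrite eqxx mulr1; congr (_ + _).
transitivity (\sum_(c : 'I_n | (b < c)%N) w' b c * X i c).
  rewrite sum_mainc; apply: eq_bigr => -[a c] /= /andP[ac _]; congr (_ * _).
  by rewrite /w'; case: pickP => [a' /(mainc_col ac)->//|/(_ a)]; rewrite ac.
rewrite big_mkcond [RHS]big_mkcond; apply: eq_bigr => c _ /=.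
rewrite !mxE mulrC; have [bc|cb] := ltnP b c.
  rewrite -val_eqE gtn_eqF //=; case: ifPn => // bcJ; rewrite (VJ0 XV) ?mul0r ?mulr0 //.
  by apply: contra bcJ => /J_above; apply.
case: eqP => //= cb'; rewrite [(b, c) \in J](negbTE _).
  by rewrite eq_sym (introF eqP cb') mulr0.
by apply/negP => /J_lt; rewrite ltnNge cb.
Qed.

(** Dual to [rrelP]: row [i] of the product takes its coefficients from column [i] of [invmx u]. If
    row [i] is normal the sum is empty. *)
Lemma lrelP X Z : X \in VJ F J ->
  lrel X Z <-> Z \in VJ F J /\ forall i, exists w : 'I_n -> F,
    forall b, (i, b) \in J ->
    Z i b = X i b + \sum_(k | (k, i) \in J) w k * X k b.
Proof.
move=> XV; split=> [[u uU ->]|[ZV /fin_all_exists[w Zw]]].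
  split=> [|i]; first exact: piJ_VJ.
  exists (fun k => invmx u k i) => b ib; rewrite mxE ib mxE.
  have /UJP uV := UJV uU.
  have ii : (i, i) \notin J by apply/negP => /J_lt; rewrite ltnn.
  rewrite (bigD1 i) //= mxE uV // eqxx mul1r; congr (_ + _).
  rewrite big_mkcond [RHS]big_mkcond; apply: eq_bigr => k _ /=; rewrite mxE.
  case: eqP => [->|ki] /=; first by rewrite (negPf ii).
  by case: ifPn => // /uV ->; rewrite (introF eqP ki) mul0r.
pose v : 'M[F]_n := \matrix_(k, i) (if (k, i) \in J then w i k else (k == i)%:R).
have vU : v \in UJ F J by apply/UJP => b c /negPf bc; rewrite mxE bc.
exists (invmx v); first exact: UJV.
apply/matrixP => i b; rewrite mxE; case: ifPn => [ib|]; last exact: VJ0.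
have ii : (i, i) \notin J by apply/negP => /J_lt; rewrite ltnn.
rewrite (Zw i b ib) invmxK mxE [RHS](bigD1 i) //= !mxE (negPf ii).
rewrite eqxx mul1r; congr (_ + _).
rewrite big_mkcond [RHS]big_mkcond; apply: eq_bigr => k _ /=; rewrite !mxE.
case: eqP => [->|_] /=; first by rewrite (negPf ii).
by case: ifP => //; rewrite mul0r.
Qed.

Lemma rrel_VJ X Z : X \in VJ F J -> rrel X Z -> Z \in VJ F J.
Proof. by move=> XV /(rrelP _ XV)[]. Qed.

Lemma lrel_VJ X Z : X \in VJ F J -> lrel X Z -> Z \in VJ F J.
Proof. by move=> XV /(lrelP _ XV)[]. Qed.

(** A normal row receives nothing, and in a column only zeros are added to the entries at or above
    its main condition, since the rows added come from strictly higher up. *)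
Lemma lrel_fixed X Z i b : X \in VJ F J -> lrel X Z ->
  normal_row J i || [forall a, ((a, b) \in mainc X) ==> (i <= a)%N] -> Z i b = X i b.
Proof.
move=> XV /(lrelP _ XV)[ZV /(_ i)[w Zw]] fx.
have [ib|ib] := boolP ((i, b) \in J); last by rewrite !(VJ0 _ ib).
rewrite Zw // big1 ?addr0 // => k ki.
case/orP: fx => [/(normal_notJ k)|/forallP fx]; first by rewrite ki.
have [->|/mainc_ex[a ab ak]] := eqVneq (X k b) 0; first by rewrite mulr0.
have /implyP/(_ ab) := fx a.
by rewrite leqNgt (leq_ltn_trans ak (J_lt ki)).
Qed.

Lemma lrel_main X Z a b : X \in VJ F J -> lrel X Z -> (a, b) \in mainc X ->
  Z a b = X a b.
Proof.
move=> XV XZ ab; apply: (lrel_fixed XV XZ); apply/orP; right.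
by apply/forallP => a'; apply/implyP => /(mainc_col ab) ->.
Qed.

Lemma lrel_mainc X Z : X \in VJ F J -> lrel X Z -> mainc Z = mainc X.
Proof.
move=> XV XZ; apply: eq_mainc => [i b Zib|a b ab]; last first.
  by rewrite (lrel_main XV XZ ab) mainc_neq0.
have [/(lrel_fixed XV XZ) Zx|] := boolP (normal_row J i ||
  [forall a, ((a, b) \in mainc X) ==> (i <= a)%N]).
  by apply: mainc_ex; rewrite -Zx.
rewrite negb_or => /andP[_ /forallPn[a]].
by rewrite negb_imply -ltnNge => /andP[ab /ltnW]; exists a.
Qed.

(* A left action reaches everything it may reach: the rows of the main
   conditions above row i form a triangular system on the columns of these
   main conditions. *)
Lemma lrel_intro X Z : X \in VJ F J -> Z \in VJ F J -> rook (mainc X) ->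
  (forall i b, Z i b != X i b ->
     ~~ normal_row J i /\ exists2 a, (a, b) \in mainc X & (a < i)%N) -> lrel X Z.
Proof.
move=> XV ZV rX XZ; apply/(lrelP _ XV); split=> // i.
have [ni|ni] := boolP (normal_row J i).
  exists (fun=> 0) => b _; rewrite big1 ?addr0 => [|k _]; last exact: mul0r.
  by apply/eqP; apply: contraLR ni => /XZ[].
pose q := [set y in mainc X | (y.1 < i)%N && (i < y.2)%N].
have qX : q \subset mainc X by apply/subsetP => y; rewrite inE => /andP[].
have [_ /(_ (fun y => Z i y.2 - X i y.2))[w ww]] := triangular_system rX qX.
pose w' k := \sum_(x in q | x.1 == k) w x.
exists w' => b ib.
have -> : \sum_(k | (k, i) \in J) w' k * X k b = \sum_(x in q) w x * X x.1 b.
  rewrite [RHS](partition_big fst (fun k => (k, i) \in J)) => [|x]; last first.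
    by rewrite inE => /andP[_ /andP[xi _]]; apply: nonnormal_J.
  by apply: eq_bigr => k _; rewrite mulr_suml; apply: eq_bigr => x /andP[_ /eqP->].
have [/existsP[a /andP[ab ai]]|/existsPn aN] :=
    boolP [exists a, ((a, b) \in mainc X) && (a < i)%N].
  have qab : (a, b) \in q by rewrite !inE ?ai ?(J_lt ib) ?andbT in ab *.
  by rewrite (ww _ qab) subrKC.
(* Column [b] has no main condition above row [i]: all rows used vanish there, and by [XZ] the entry
   does not change either. *)
rewrite big1 => [|[c d] /=]; last first.
  rewrite inE => /andP[_ /andP[/= ci _]].
  have [->|/mainc_ex[a ab ac]] := eqVneq (X c b) 0; first by rewrite mulr0.
  by have := aN a; rewrite ab (leq_ltn_trans ac ci).
rewrite addr0; apply/eqP; case: eqVneq => // /XZ[_ [a ab ai]].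
by have := aN a; rewrite ab ai.
Qed.

End Orbits.

(** * Existence and uniqueness of templates in right orbits *)

Section Templates.

Variables (F : finFieldType) (n : nat) (J : {set 'I_n * 'I_n}).
Hypothesis J_cc : column_closed J.
Implicit Types (a b c i k t : 'I_n) (X Z C u : 'M[F]_n).
Implicit Types (p q : {set 'I_n * 'I_n}).

Lemma template_VJ X : template J X -> X \in VJ F J.
Proof. by case/andP. Qed.

Lemma template_left X a b k : template J X -> (a, b) \in mainc X ->
  (k < b)%N -> X a k = 0.
Proof.
case/andP=> XV /forall_inP XT ab kb.
have [akJ|] := boolP ((a, k) \in J); last exact: VJ0.
by apply/eqP; have /forallP/(_ k)/implyP := XT _ ab; apply; rewrite kb.
Qed.

Lemma templateP X : X \in VJ F J ->
  (forall a b k, (a, b) \in mainc X -> (k < b)%N -> X a k = 0) -> template J X.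
Proof.
move=> XV XT; rewrite /template XV; apply/forall_inP => -[a b] ab.
by apply/forallP => k; apply/implyP => /andP[kb _]; rewrite (XT a b).
Qed.

Lemma template_rook X : template J X -> rook (mainc X).
Proof.
move=> XT a b c ab ac; apply: ord_inj; case: (ltngtP b c) => // lt.
  by have := mainc_neq0 ab; rewrite (template_left XT ac lt) eqxx.
by have := mainc_neq0 ac; rewrite (template_left XT ab lt) eqxx.
Qed.

(** The entry lies below the main condition of its column. A main hook intersection would lie to the
    left of a main condition in row [t], where a template is zero. *)
Lemma template_suppl X t b : template J X -> X t b != 0 ->
  (t, b) \notin mainc X -> (t, b) \in suppl (mainc X).
Proof.
move=> XT Xtb mtb; have [a ab at_] := mainc_ex Xtb; rewrite inE; apply/andP; split.
  apply/exists_inP; exists (a, b) => //; rewrite inE /= eqxx andbT.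
  rewrite (J_lt J_cc (VJ_neq0 (template_VJ XT) Xtb)) andbT ltn_neqAle at_ andbT.
  by apply: contraNN mtb => /eqP/val_inj <-.
apply/existsP => -[i /existsP[l /and5P[_ _ /= bl _ tl]]].
by rewrite (template_left XT tl bl) eqxx in Xtb.
Qed.

Lemma YpJ_P p t b : (t, b) \in YpJ p J ->
  [/\ ~~ normal_row J t, (t < b)%N, exists2 a, (a, b) \in p & (a < t)%N
    & forall l : 'I_n, (b < l)%N -> (t, l) \notin p].
Proof.
rewrite inE => /andP[+ nt]; rewrite inE => /andP[/exists_inP[[a c] ac]].
rewrite inE => /and3P[/= at_ tc /eqP bc] mhi; rewrite -{}bc in ac tc.
split=> //; first by exists a.
move=> l bl; apply: contra mhi => tl.
by apply/existsP; exists a; apply/existsP; exists l; apply/and5P.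
Qed.

Lemma normal_templateP X : reflect
  (template J X /\
   forall t b, ~~ normal_row J t -> X t b != 0 -> (t, b) \in mainc X)
  (normal_template J X).
Proof.
apply: (iffP andP) => -[XT XN]; split=> //.
  move=> t b /negPf nt Xtb; have /forallP/(_ (t, b))/implyP/(_ Xtb) := XN.
  by rewrite /= nt andbF orbF.
apply/forallP => -[t b]; apply/implyP => /= Xtb; apply/orP.
have [|mtb] := boolP ((t, b) \in mainc X); [by left | right].
rewrite template_suppl //; apply: contraR mtb => nt; exact: XN.
Qed.

(** The left action fixes the normal rows and the main entries, and a normal template is zero
    elsewhere. Hence $[A(v)]$ does not depend on the choice of $y_v$. *)
Lemma lrel_normal_template X Z1 Z2 : X \in VJ F J -> lrel J X Z1 -> lrel J X Z2 ->
  normal_template J Z1 -> normal_template J Z2 -> Z1 = Z2.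
Proof.
move=> XV L1 L2 /normal_templateP[_ N1] /normal_templateP[_ N2].
apply/matrixP => t b; have [nt|nt] := boolP (normal_row J t).
  by rewrite (lrel_fixed J_cc XV L1) ?nt // (lrel_fixed J_cc XV L2) ?nt.
have [m|m] := boolP ((t, b) \in mainc X).
  by rewrite (lrel_main J_cc XV L1 m) (lrel_main J_cc XV L2 m).
have z Z : lrel J X Z -> (Z t b != 0 -> (t, b) \in mainc Z) -> Z t b = 0.
  move=> L N; apply/eqP; apply: contraNT m => /N.
  by rewrite (lrel_mainc J_cc XV L).
by rewrite (z _ L1 (N1 _ _ nt)) (z _ L2 (N2 _ _ nt)).
Qed.

(** Row [t] of a linear combination of the columns of $\tilde A(a,b)$. *)
Definition gamma_sum X a b (w : 'I_n * 'I_n -> F) t : F :=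
  \sum_(y in main_Gamma J X a b) w y * X t y.2.

Lemma main_GammaP X a b y : X \in VJ F J ->
  y \in main_Gamma J X a b =
  [&& y \in mainc X, (a < y.1)%N, (y.1 < b)%N & (b < y.2)%N].
Proof.
move=> XV; rewrite inE; case: (boolP (y \in mainc X)) => //=.
by case: y => c d /mainc_neq0/(VJ_neq0 XV) ->.
Qed.

Lemma gamma_sum0 X a b w t : X \in VJ F J -> (t <= a)%N -> gamma_sum X a b w t = 0.
Proof.
move=> XV ta; apply: big1 => -[c d]; rewrite main_GammaP // => /and4P[cd /= ac _ _].
by rewrite (mainc_above cd) ?mulr0 // (leq_ltn_trans ta).
Qed.

Lemma rrel_intro X Z : X \in VJ F J -> Z \in VJ F J ->
  (forall b, (forall t, Z t b = X t b) \/ exists a w,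
     forall t, (t < b)%N -> Z t b = X t b + gamma_sum X a b w t) ->
  rrel J X Z.
Proof.
move=> XV ZV XZ; apply/(rrelP J_cc _ XV); split=> // b.
case: (XZ b) => [H|[a [w H]]].
  by exists (fun=> 0) => i _; rewrite big1 ?addr0 => [|y _]; rewrite ?H ?mul0r.
exists (fun y => if y \in main_Gamma J X a b then w y else 0) => i ib.
rewrite H ?(J_lt J_cc ib) //; congr (_ + _).
rewrite /gamma_sum big_mkcond [RHS]big_mkcond; apply: eq_bigr => y _ /=.
rewrite main_GammaP //; case: (y \in mainc X) => //=.
by case: (b < y.2)%N; rewrite ?andbF ?andbT //; case: ifP; rewrite ?mul0r.
Qed.

(* By triangularity, the columns whose main condition lies above row a get
   coefficient 0. *)
Lemma rrel_gamma X Z a b : X \in VJ F J -> rook (mainc X) -> rrel J X Z ->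
  (a, b) \in mainc X -> (forall i, (i < a)%N -> Z i b = 0) ->
  exists w, forall t, (t < b)%N -> Z t b = X t b + gamma_sum X a b w t.
Proof.
move=> XV rX /(rrelP J_cc _ XV)[ZV /(_ b)[w Zw]] ab Z0.
have abJ : (a, b) \in J by apply: (VJ_neq0 XV); apply: mainc_neq0.
exists w => t tb; rewrite Zw ?(J_above J_cc abJ) //; congr (_ + _).
pose q := [set y in mainc X | (b < y.2)%N && (y.1 < a)%N].
have w0 : forall x, x \in q -> w x = 0.
  apply: (triangular_zero rX); first by apply/subsetP => y; rewrite inE => /andP[].
  move=> [c d]; rewrite inE => /and3P[cd /= bd ca].
  have := Zw c; rewrite Z0 // (mainc_above ab ca) add0r (J_above J_cc abJ); last first.
    exact: ltn_trans ca (J_lt J_cc abJ).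
  move/(_ isT) => H; rewrite [RHS]H [RHS](bigID (fun y : 'I_n * 'I_n => (y.1 < a)%N)) /=.
  rewrite [X in _ = _ + X]big1 ?addr0.
    by apply: eq_bigl => y; rewrite inE andbA.
  move=> [e f] /andP[/andP[ef _]]; rewrite -leqNgt => ae.
  by rewrite (mainc_above ef) ?mulr0 // (leq_trans ca).
rewrite /gamma_sum big_mkcond [RHS]big_mkcond; apply: eq_bigr => -[c d] _ /=.
rewrite main_GammaP //=; case: (boolP ((c, d) \in mainc X)) => //= cd.
case: (boolP (b < d)%N) => [bd|]; rewrite ?andbF ?andbT //.
(* A main condition to the right of [b] either belongs to [main_Gamma], or starts at or below row
   [b] and so vanishes in row [t], or lies above row [a] and has coefficient 0; row [a] itself is
   excluded by the rook condition. *)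
case: (ltngtP a c) => [ac|ca|/val_inj ac] /=.
- case: ltnP => // bc; rewrite (mainc_above cd) ?mulr0 //; exact: leq_trans bc.
- by rewrite w0 ?mul0r // inE /= cd bd.
- by move: bd; rewrite -ac in cd *; rewrite (rX _ _ _ ab cd) ltnn.
Qed.

(** In the row of a main condition to the right of [b], both templates vanish in column [b].
    Triangularity therefore kills every coefficient that could change column [b] within [J]. *)
Lemma rrel_template X Z : template J X -> template J Z -> mainc Z = mainc X ->
  rrel J X Z -> Z = X.
Proof.
move=> XT ZT mZX; have XV := template_VJ XT; have ZV := template_VJ ZT.
move=> /(rrelP J_cc _ XV)[_ Zw].
apply/matrixP => i b; have [ib|ib] := boolP ((i, b) \in J); last first.
  by rewrite (VJ0 XV ib) (VJ0 ZV ib).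
have [w Zb] := Zw b.
pose q := [set y in mainc X | (b < y.2)%N && (y.1 < b)%N].
have w0 : forall x, x \in q -> w x = 0.
  apply: (triangular_zero (template_rook XT)).
    by apply/subsetP => y; rewrite inE => /andP[].
  move=> [c d]; rewrite inE => /and3P[cd /= bd cb].
  have := Zb c; rewrite (template_left XT cd bd).
  rewrite -mZX in cd; rewrite (template_left ZT cd bd) add0r (J_above J_cc ib) //.
  move/(_ isT) => H; rewrite [RHS]H [RHS](bigID (fun y : 'I_n * 'I_n => (y.1 < b)%N)) /=.
  rewrite [X in _ = _ + X]big1 ?addr0.
    by apply: eq_bigl => y; rewrite inE andbA.
  move=> [e f] /andP[/andP[ef _]]; rewrite -leqNgt => be.
  by rewrite (mainc_above ef) ?mulr0 // (leq_trans cb).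
rewrite Zb // big1 ?addr0 // => -[c d] /andP[cd /= bd].
have [cb|bc] := ltnP c b; first by rewrite w0 ?mul0r // inE /= cd bd.
by rewrite (mainc_above cd) ?mulr0 //; apply: leq_trans bc; apply: (J_lt J_cc).
Qed.

(** For each column a triangular system supplies a combination of columns of $\tilde Z(a,b)$ that
    clears the rows of the main conditions in [main_Gamma]. All columns are corrected at once with
    the original columns of [Z], and only strictly below their main conditions. *)
Lemma rrel_reduce Z : Z \in VJ F J -> rook (mainc Z) ->
  exists C, [/\ template J C, mainc C = mainc Z & rrel J Z C].
Proof.
move=> ZV rZ.
have : forall b, exists w : 'I_n * 'I_n -> F, forall a, (a, b) \in mainc Z ->
    forall x, x \in main_Gamma J Z a b ->
    Z x.1 b + \sum_(y in main_Gamma J Z a b) w y * Z x.1 y.2 = 0.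
  move=> b; case: (pickP (fun a => (a, b) \in mainc Z)) => [a ab|b0]; last first.
    by exists (fun=> 0) => a; rewrite b0.
  have qZ : main_Gamma J Z a b \subset mainc Z.
    by apply/subsetP => y; rewrite inE => /andP[].
  have [/(_ (fun y => - Z y.1 b))[w ww] _] := triangular_system rZ qZ.
  by exists w => a' /(mainc_col ab) <- x /ww ->; rewrite subrr.
case/fin_all_exists => w ww.
pose top b := [pick a | (a, b) \in mainc Z].
(* The test [t < b] keeps [C] in V, since the columns combined may have nonzero entries in rows at
   or below [b]. *)
pose C : 'M[F]_n := \matrix_(t, b) (if (t < b)%N then
   Z t b + (if top b is Some a then gamma_sum Z a b (w b) t else 0) else 0).
have C0 t b : (forall a, (a, b) \notin mainc Z) -> C t b = 0.
  move=> b0; rewrite mxE /top; case: pickP => [a|_]; first by rewrite (negPf (b0 a)).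
  rewrite addr0; case: ifP => // _; apply/eqP; case: eqVneq => // /mainc_ex[a].
  by rewrite (negPf (b0 a)).
have CE t a b : (a, b) \in mainc Z -> (t < b)%N ->
    C t b = Z t b + gamma_sum Z a b (w b) t.
  move=> ab tb; rewrite mxE tb /top.
  by case: pickP => [a' /(mainc_col ab) <-//|/(_ a)]; rewrite ab.
have abJ a b : (a, b) \in mainc Z -> (a, b) \in J.
  by move=> /mainc_neq0; apply: VJ_neq0.
have Cm a b : (a, b) \in mainc Z -> C a b = Z a b.
  by move=> ab; rewrite (CE a a b) ?gamma_sum0 ?addr0 // (J_lt J_cc) ?abJ.
have CV : C \in VJ F J.
  apply/VJP => t b tb; case: (boolP [exists a, (a, b) \in mainc Z]) => [|/existsPn/C0//].
  case/existsP => a ab; rewrite mxE; case: ifP => // tb'.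
  by rewrite (J_above J_cc (abJ _ _ ab) tb') in tb.
have mC : mainc C = mainc Z.
  apply: eq_mainc => [t b Ctb|a b ab]; last by rewrite Cm // mainc_neq0.
  case: (boolP [exists a, (a, b) \in mainc Z]) => [/existsP[a ab]|/existsPn b0]; last first.
    by rewrite C0 ?eqxx in Ctb.
  exists a => //; have tb := J_lt J_cc (VJ_neq0 CV Ctb).
  rewrite leqNgt; apply: contraNN Ctb => ta; rewrite (CE _ _ _ ab) //.
  by rewrite (mainc_above ab) // gamma_sum0 ?addr0 // ltnW.
exists C; split=> //.
  apply: templateP => // c d b; rewrite mC => cd bd.
  have [->//|Ccb] := eqVneq (C c b) 0.
  have cb := J_lt J_cc (VJ_neq0 CV Ccb).
  have [a] := mainc_ex Ccb; rewrite mC leq_eqVlt => ab /orP[/eqP/val_inj ac|ac].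
    by move: bd; rewrite -ac in cd; rewrite (rZ _ _ _ ab cd) ltnn.
  have cdG : (c, d) \in main_Gamma J Z a b by rewrite main_GammaP // cd ac cb.
  by rewrite (CE _ _ _ ab) // (ww _ _ ab _ cdG).
apply: rrel_intro => // b.
case: (boolP [exists a, (a, b) \in mainc Z]) => [/existsP[a ab]|/existsPn b0].
  by right; exists a, (w b) => t; apply: CE.
left=> t; rewrite C0 //; apply/esym/eqP; case: eqVneq => // /mainc_ex[a].
by rewrite (negPf (b0 a)).
Qed.

End Templates.

(** * Lidempotents as characters of V and their orbits *)

Section Characters.

Variables (F : finFieldType) (n : nat) (J : {set 'I_n * 'I_n}).
Hypothesis J_cc : column_closed J.
Variables (R : realType) (theta : F -> R[i]).
Hypothesis theta_char : nontrivial_character theta.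
Implicit Types (X Y Z C u g h : 'M[F]_n) (B : Vtype F J) (chi f : CV F R J).

Notation lid := (lid theta J).

Lemma toVK X : X \in VJ F J -> val (toV J X) = X.
Proof. exact: piJ_id. Qed.

Lemma valK_toV B : toV J (val B) = B.
Proof. by apply: val_inj; rewrite toVK ?(valP B). Qed.

Lemma theta0 : theta 0 = 1. Proof. by case: theta_char. Qed.

Lemma thetaD x y : theta (x + y) = theta x * theta y.
Proof. by case: theta_char. Qed.

Lemma theta_neq0 x : theta x != 0.
Proof.
apply/eqP => x0; have := theta0; rewrite -(subrr x) thetaD x0 mul0r => /eqP.
by rewrite eq_sym oner_eq0.
Qed.

Lemma lidE X B : lid X B = theta (\tr (X^T *m val B)).
Proof. by rewrite ffunE pairing_tr // (valP B) orbT. Qed.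

Lemma lid_neq0 X B : lid X B != 0.
Proof. by rewrite lidE theta_neq0. Qed.

Lemma lidDl X Y B : lid (X + Y) B = lid X B * lid Y B.
Proof. by rewrite !lidE -thetaD linearD mulmxDl linearD. Qed.

Lemma lidDr X Y Z : Y \in VJ F J -> Z \in VJ F J ->
  lid X (toV J (Y + Z)) = lid X (toV J Y) * lid X (toV J Z).
Proof.
by move=> YV ZV; rewrite !lidE -thetaD -linearD -mulmxDr !toVK // VJD.
Qed.

Lemma lidC X Y : X \in VJ F J -> Y \in VJ F J ->
  lid X (toV J Y) = lid Y (toV J X).
Proof.
by move=> XV YV; rewrite !lidE !toVK // -mxtrace_tr trmx_mul trmxK.
Qed.

Lemma VJN X : X \in VJ F J -> - X \in VJ F J.
Proof. by move=> XV; apply/VJP => i b ib; rewrite mxE (VJ0 XV) ?oppr0. Qed.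

Lemma lid_nontrivial X : X \in VJ F J -> X != 0 ->
  exists B, lid X B != 1.
Proof.
move=> XV X0; have [[i b] /= Xib] : exists y : 'I_n * 'I_n, X y.1 y.2 != 0.
  apply/existsP; apply: contraNT X0 => /existsPn H.
  by apply/eqP/matrixP => i b; rewrite mxE; have /negPn/eqP := H (i, b).
have [_ _ [x x1]] := theta_char.
(* This multiple of a matrix unit pairs with [X] to [x], where [theta] is not 1. *)
have DV : (x / X i b) *: delta_mx i b \in VJ F J.
  apply/VJP => k c kc; rewrite !mxE; case: eqP => [ki|]; last by rewrite mulr0.
  case: eqP => [cb|]; last by rewrite mulr0.
  by move: Xib; rewrite -ki -cb (VJ0 XV kc) eqxx.
exists (toV J ((x / X i b) *: delta_mx i b)).
rewrite lidE toVK // -scalemxAr linearZ /= mxtrace_mulC.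
suff -> : \tr (delta_mx i b *m X^T) = X i b by rewrite divfK.
rewrite /mxtrace (bigD1 i) //= mxE (bigD1 b) //= !mxE !eqxx mul1r.
rewrite big1 => [|k /negPf kb]; last by rewrite !mxE kb andbF mul0r.
rewrite addr0 big1 ?addr0 // => k /negPf ki; rewrite mxE big1 // => c _.
by rewrite !mxE ki mul0r.
Qed.

Lemma lid_inj X Y : X \in VJ F J -> Y \in VJ F J -> lid X = lid Y -> X = Y.
Proof.
move=> XV YV XY; apply/eqP; rewrite -subr_eq0; apply/negPn/negP.
case/(lid_nontrivial (VJD XV (VJN YV))) => B /eqP; apply.
rewrite lidDl XY -lidDl subrr lidE trmx0 mul0mx linear0 theta0 //.
Qed.

Lemma lact_comp u w chi : u \in UJ F J -> w \in UJ F J ->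
  lact u (lact w chi) = lact (u *m w) chi.
Proof.
move=> uU wU; apply/ffunP => B; rewrite !ffunE toVK; last exact: mulinv_VJ (valP B) uU.
by rewrite mulmxA (invmxM J_cc).
Qed.

Lemma ract_comp u w chi : u \in UJ F J -> w \in UJ F J ->
  ract u (ract w chi) = ract (w *m u) chi.
Proof.
move=> uU wU; apply/ffunP => B; rewrite !ffunE toVK; last exact: mulVJ_inv (valP B) uU.
by rewrite -mulmxA -(invmxM J_cc).
Qed.

Lemma lract_comm u w chi : u \in UJ F J -> w \in UJ F J ->
  lact u (ract w chi) = ract w (lact u chi).
Proof.
move=> uU wU; apply/ffunP => B; rewrite !ffunE !toVK ?mulmxA //.
- exact: mulVJ_inv (valP B) wU.
- exact: mulinv_VJ (valP B) uU.
Qed.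

Lemma lact1 chi : lact 1%:M chi = chi.
Proof. by apply/ffunP => B; rewrite ffunE invmx1 mul1mx valK_toV. Qed.

Lemma ract1 chi : ract 1%:M chi = chi.
Proof. by apply/ffunP => B; rewrite ffunE invmx1 mulmx1 valK_toV. Qed.

Lemma lactK u chi : u \in UJ F J -> lact (invmx u) (lact u chi) = chi.
Proof. by move=> uU; rewrite lact_comp ?UJV // mulVmx ?lact1 // (UJ_unit J_cc). Qed.

Lemma ractK u chi : u \in UJ F J -> ract (invmx u) (ract u chi) = chi.
Proof. by move=> uU; rewrite ract_comp ?UJV // mulmxV ?ract1 // (UJ_unit J_cc). Qed.

Lemma orbrP X chi :
  reflect (exists2 u, u \in UJ F J & chi = ract u (lid X)) (chi \in orbr theta J X).
Proof. exact: imageP. Qed.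

Lemma orblP X chi :
  reflect (exists2 u, u \in UJ F J & chi = lact u (lid X)) (chi \in orbl theta J X).
Proof. exact: imageP. Qed.

Lemma orbr_rrel X chi : X \in VJ F J -> chi \in orbr theta J X ->
  exists2 Z, rrel J X Z & chi = lid Z.
Proof.
move=> XV /orbrP[u uU ->]; exists (ractm J u X); first by exists u.
by rewrite ract_lid.
Qed.

Lemma orbl_lrel X chi : X \in VJ F J -> chi \in orbl theta J X ->
  exists2 Z, lrel J X Z & chi = lid Z.
Proof.
move=> XV /orblP[u uU ->]; exists (lactm J u X); first by exists u.
by rewrite lact_lid.
Qed.

Lemma lid_orbr X Z : X \in VJ F J -> Z \in VJ F J ->
  lid Z \in orbr theta J X <-> rrel J X Z.
Proof.
move=> XV ZV; split=> [/(orbr_rrel XV)[Z' XZ' /lid_inj ->//]|[u uU ->]].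
  exact: rrel_VJ XV XZ'.
by apply/orbrP; exists u; rewrite ?ract_lid.
Qed.

Lemma lid_orbl X Z : X \in VJ F J -> Z \in VJ F J ->
  lid Z \in orbl theta J X <-> lrel J X Z.
Proof.
move=> XV ZV; split=> [/(orbl_lrel XV)[Z' XZ' /lid_inj ->//]|[u uU ->]].
  exact: lrel_VJ XV XZ'.
by apply/orblP; exists u; rewrite ?lact_lid.
Qed.

Lemma orbr_sub X Z : X \in VJ F J -> rrel J X Z ->
  {subset orbr theta J Z <= orbr theta J X}.
Proof.
move=> XV [u uU ->] chi /orbrP[w wU ->]; apply/orbrP; exists (u *m w).
  exact: UJM.
by rewrite -ract_lid // ract_comp.
Qed.

Lemma orbl_sub X Z : X \in VJ F J -> lrel J X Z ->
  {subset orbl theta J Z <= orbl theta J X}.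
Proof.
move=> XV [u uU ->] chi /orblP[w wU ->]; apply/orblP; exists (w *m u).
  exact: UJM.
by rewrite -lact_lid // lact_comp.
Qed.

Lemma rrel_sym X Z : X \in VJ F J -> rrel J X Z -> rrel J Z X.
Proof.
move=> XV XZ; have ZV := rrel_VJ J_cc XV XZ; apply/lid_orbr => //.
case: XZ => u uU ->; apply/orbrP; exists (invmx u); first exact: UJV.
by rewrite -ract_lid // ractK.
Qed.

Lemma lrel_sym X Z : X \in VJ F J -> lrel J X Z -> lrel J Z X.
Proof.
move=> XV XZ; have ZV := lrel_VJ J_cc XV XZ; apply/lid_orbl => //.
case: XZ => u uU ->; apply/orblP; exists (invmx u); first exact: UJV.
by rewrite -lact_lid // lactK.
Qed.

Lemma rrel_trans X Y Z : X \in VJ F J -> rrel J X Y -> rrel J Y Z -> rrel J X Z.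
Proof.
move=> XV XY YZ; have YV := rrel_VJ J_cc XV XY; have ZV := rrel_VJ J_cc YV YZ.
by apply/lid_orbr => //; apply: (orbr_sub XV XY); apply/lid_orbr.
Qed.

Lemma lrel_trans X Y Z : X \in VJ F J -> lrel J X Y -> lrel J Y Z -> lrel J X Z.
Proof.
move=> XV XY YZ; have YV := lrel_VJ J_cc XV XY; have ZV := lrel_VJ J_cc YV YZ.
by apply/lid_orbl => //; apply: (orbl_sub XV XY); apply/lid_orbl.
Qed.

(** The two actions commute, so the left action permutes right orbits. *)
Lemma rrel_lactm u X Z : u \in UJ F J -> X \in VJ F J -> rrel J X Z ->
  rrel J (lactm J u X) (lactm J u Z).
Proof.
move=> uU XV [w wU ->]; apply/lid_orbr; rewrite ?piJ_VJ //; apply/orbrP; exists w => //.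
by rewrite -!lact_lid ?piJ_VJ // -ract_lid // lract_comm.
Qed.

Lemma lid_in_orbr X : lid X \in orbr theta J X.
Proof. by apply/orbrP; exists 1%:M; rewrite ?UJ1 ?ract1. Qed.

Lemma orbbiP X chi : reflect
  (exists u w, [/\ u \in UJ F J, w \in UJ F J & chi = lact u (ract w (lid X))])
  (chi \in orbbi theta J X).
Proof.
apply: (iffP allpairsP) => [[[u w] [/= uU wU ->]]|[u [w [uU wU ->]]]].
  by rewrite !mem_enum in uU wU; exists u, w.
by exists (u, w); rewrite /= !mem_enum.
Qed.

Lemma orbbi_lr X chi : X \in VJ F J -> chi \in orbbi theta J X <->
  exists2 Z, lrel J X Z & chi \in orbr theta J Z.
Proof.
move=> XV; split=> [/orbbiP[u [w [uU wU ->]]]|[_ [u uU ->] /orbrP[w wU ->]]].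
  exists (lactm J u X); first by exists u.
  by rewrite lract_comm //; apply/orbrP; exists w; rewrite ?lact_lid.
by apply/orbbiP; exists u, w; rewrite lract_comm // lact_lid.
Qed.

Lemma orbbi_rl X Y Z chi : X \in VJ F J -> rrel J X Y -> lrel J Y Z ->
  chi \in orbr theta J Z -> chi \in orbbi theta J X.
Proof.
move=> XV [w wU ->] [u uU ->] /orbrP[g gU ->].
rewrite -!(lact_lid, ract_lid) ?piJ_VJ // lract_comm // ract_comp //.
by apply/orbbiP; exists u, (w *m g); rewrite UJM // lract_comm ?UJM.
Qed.

End Characters.

(** * Isomorphic right orbit modules and biorbits *)

Section CUIsomorphism.

Variables (F : finFieldType) (n : nat) (J : {set 'I_n * 'I_n}).
Hypothesis J_cc : column_closed J.
Variables (R : realType) (theta : F -> R[i]).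
Hypothesis theta_char : nontrivial_character theta.
Implicit Types (X Y Z C D u g h : 'M[F]_n) (B : Vtype F J) (chi f : CV F R J).

Notation lid := (lid theta J).

(** Translating the summation variable by some [B0] with [lid D B0 != 1] multiplies the sum by that
    value. *)
Lemma sum_lid D : D \in VJ F J -> D != 0 -> \sum_B lid D B = 0.
Proof.
move=> DV D0; have [B0 c1] := lid_nontrivial theta_char DV D0.
have B0V := valP B0; pose t B := toV J (val B + val B0).
have tK : cancel t (fun B => toV J (val B - val B0)).
  by move=> B; rewrite /t toVK ?VJD ?(valP B) // addrK valK_toV.
have S : \sum_B lid D B = lid D B0 * \sum_B lid D B.
  rewrite mulr_sumr [LHS](reindex_inj (can_inj tK)); apply: eq_bigr => B _.
  by rewrite /t (lidDr theta_char) ?(valP B) // !valK_toV mulrC.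
apply/eqP; have /eqP := S; rewrite -subr_eq0 -[X in X - _]mul1r -mulrBl mulf_eq0.
by rewrite subr_eq0 eq_sym (negPf c1).
Qed.

Lemma lidB X B B0 :
  lid X B * lid X (toV J (- val B0)) = lid X (toV J (val B - val B0)).
Proof.
by rewrite [RHS](lidDr theta_char) ?VJN ?(valP B) ?(valP B0) // valK_toV.
Qed.

(** Fourier inversion: the coefficients, weighted by the characters at [- B0] and summed, give the
    order of V times [f B0]. The symmetry [lidC] turns the sum over characters into one over V,
    where [sum_lid] applies. *)
Lemma fourier_inj f : (forall Y, Y \in VJ F J -> \sum_B f B * lid Y B = 0) -> f = 0.
Proof.
move=> f0; apply/ffunP => B0; rewrite [RHS]ffunE.
have : \sum_(Y : Vtype F J) (\sum_B f B * lid (val Y) B) *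
    lid (val Y) (toV J (- val B0)) = 0.
  by apply: big1 => Y _; rewrite f0 ?mul0r // (valP Y).
under eq_bigr => Y _ do rewrite mulr_suml.
rewrite exchange_big (bigD1 B0) //= [X in _ + X]big1 ?addr0 => [|B B0B].
  under eq_bigr => Y _.
    rewrite -mulrA lidB subrr lidE toVK; last by apply/VJP => i b _; rewrite mxE.
    rewrite mulmx0 linear0 (theta0 theta_char) mulr1; over.
  rewrite sumr_const => /eqP; rewrite mulrn_eq0 => /orP[/eqP c0|/eqP//].
  by have := fintype0 B0 c0.
have BV : val B - val B0 \in VJ F J by exact: VJD (valP B) (VJN (valP B0)).
under eq_bigr => Y _.
  rewrite -mulrA lidB lidC ?(valP Y) // valK_toV; over.
rewrite -mulr_sumr sum_lid ?mulr0 // subr_eq0.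
by apply: contra B0B => /eqP/val_inj ->.
Qed.

Lemma scale_CV (a : R[i]) f B : (a *: f) B = a * f B.
Proof. by rewrite ffunE. Qed.

Lemma span_annihilator (s : seq (CV F R J)) (h : Vtype F J -> R[i]) f :
  (forall chi, chi \in s -> \sum_B chi B * h B = 0) ->
  f \in <<s>>%VS -> \sum_B f B * h B = 0.
Proof.
move=> s0 fs; rewrite (coord_span (X := in_tuple s) fs).
under eq_bigr => B _ do rewrite sum_ffunE mulr_suml.
rewrite exchange_big big1 //= => i _.
transitivity (coord (in_tuple s) i f * \sum_B s`_i B * h B).
  by rewrite mulr_sumr; apply: eq_bigr => B _; rewrite ffunE /GRing.scale /= mulrA.
by rewrite s0 ?mulr0 // mem_nth.
Qed.

Lemma unit1DVJ B : 1%:M + val B \in UJ F J.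
Proof. by rewrite inE addrAC subrr add0r (valP B). Qed.

Lemma CU_iso_orbbi C A : C \in VJ F J -> A \in VJ F J ->
  CU_iso <<orbr theta J C>> <<orbr theta J A>> -> lid C \in orbbi theta J A.
Proof.
move=> CV0 AV [phi [phiW phi_inj phiE]].
have CW : lid C \in <<orbr theta J C>>%VS.
  by apply/memv_span/lid_in_orbr.
pose f := phi (lid C).
have fA : f \in <<orbr theta J A>>%VS by rewrite -phiW memv_img.
have f0 : f != 0.
  apply/eqP => fe; have /phi_inj H : phi (lid C) = phi 0 by rewrite linear0.
  have /ffunP/(_ (toV J 0))/eqP := H CW (mem0v _).
  by rewrite [X in _ == X]ffunE (negPf (lid_neq0 theta_char _ _)).
(* Coefficients of the functional [k -> phi k 0] in the basis of indicator functions. *)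
pose c (D : Vtype F J) := phi [ffun B => ((B == D)%:R : R[i]^o)] (toV J 0).
have phi0 (k : CV F R J) : phi k (toV J 0) = \sum_(D : Vtype F J) k D * c D.
  have {1}-> : k = \sum_(D : Vtype F J) k D *: [ffun B => ((B == D)%:R : R[i]^o)].
    apply/ffunP => B; rewrite sum_ffunE.
    transitivity (\sum_(D : Vtype F J) k D * (B == D)%:R).
      rewrite (bigD1 B) //= eqxx mulr1 big1 ?addr0 // => D /negPf DB.
      by rewrite eq_sym DB mulr0.
    by apply: eq_bigr => D _; rewrite scale_CV; congr (_ * _); rewrite ffunE.
  rewrite linear_sum sum_ffunE; apply: eq_bigr => D _.
  by rewrite linearZ ffunE.
(* For [g] inverse to [1 + B], [f B] is the value at 0 of [mact g f], that is, of
   [phi (mact g (lid C))]. Right translation by [g] evaluated at [D] and left translation by the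
   inverse of [1 + D] evaluated at [B] share the factor [lid C] at the product [D B]; exchanging the
   roles of [B] and [D] turns right translates of $[C]$ into left ones. *)
have fC : f \in <<orbl theta J C>>%VS.
  suff -> : f = \sum_(D : Vtype F J) (lid C D * c D) *: lact (invmx (1%:M + val D)) (lid C).
    apply: memv_suml => D _; apply/memvZ/memv_span/orblP.
    by exists (invmx (1%:M + val D)); rewrite ?(UJV J_cc) ?unit1DVJ.
  apply/ffunP => B; rewrite sum_ffunE.
  pose g := invmx (1%:M + val B).
  have gU : g \in UJ F J by rewrite (UJV J_cc) ?unit1DVJ.
  have gB : toV J (invmx g - 1%:M) = B by rewrite invmxK addrC addKr valK_toV.
  have -> : f B = mact g f (toV J 0).
    by rewrite ffunE toVK ?mul0mx ?add0r ?gB //; apply/VJP => i b _; rewrite mxE.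
  rewrite -phiE // mact_lid // gB linearZ scale_CV phi0 mulr_sumr; apply: eq_bigr => D _.
  have DBV : val D *m val B \in VJ F J by exact: VJM J_cc (valP D) (valP B).
  have rE : ract g (lid C) D = lid C D * lid C (toV J (val D *m val B)).
    rewrite ffunE invmxK mulmxDr mulmx1 (lidDr theta_char) ?(valP D) //.
    by rewrite valK_toV.
  have lE : lact (invmx (1%:M + val D)) (lid C) B =
      lid C B * lid C (toV J (val D *m val B)).
    rewrite ffunE invmxK mulmxDl mul1mx (lidDr theta_char) ?(valP B) //.
    by rewrite valK_toV.
  rewrite scale_CV rE lE !mulrA (mulrC (lid C B)) -!mulrA; congr (_ * _).
  by rewrite mulrA mulrC.
(* A common element $u.[C]=[A].w$ gives $[C]=u^{-1}.[A].w$. *)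
have [|no] := boolP (has (mem (orbr theta J A)) (orbl theta J C)).
  case/hasP => chi /orblP[u uU ->] /orbrP[w wU e].
  apply/orbbiP; exists (invmx u), w; rewrite -e lactK // UJV //.
(* When the orbits are disjoint, [lid (- Y)] is missing from one of them. Pairing with [lid Y] kills
   every other character, hence the whole span of that orbit, which contains [f]. *)
case/eqP: f0; apply: fourier_inj => Y YV.
have kill (s : seq (CV F R J)) : (forall chi, chi \in s -> exists2 Z, Z \in VJ F J & chi = lid Z) ->
    lid (- Y) \notin s -> f \in <<s>>%VS -> \sum_B f B * lid Y B = 0.
  move=> sl Ys; apply: span_annihilator => chi chis; have [Z ZV chiZ] := sl chi chis.
  rewrite chiZ; under eq_bigr => B _ do rewrite -lidDl //.
  apply: sum_lid; first exact: VJD.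
  by apply: contraNneq Ys => /eqP; rewrite addr_eq0 => /eqP <-; rewrite -chiZ.
have [YA|YA] := boolP (lid (- Y) \in orbr theta J A).
  apply: kill fC => [chi /(orbl_lrel J_cc CV0)[Z CZ ->]|].
    by exists Z => //; apply: lrel_VJ CZ.
  by apply: contraNN no => YC; apply/hasP; exists (lid (- Y)).
apply: kill fA => // chi /(orbr_rrel J_cc AV)[Z CZ ->].
by exists Z => //; apply: rrel_VJ CZ.
Qed.

(* Left multiplication by u^-1 on the group algebra, transported to functions on
   V along g |-> g - E. *)
Definition lmul u f : CV F R J :=
  [ffun B : Vtype F J => f (toV J (u *m (1%:M + val B) - 1%:M))].

Lemma lmul_is_linear u : linear (lmul u).
Proof. by move=> a f1 f2; apply/ffunP => B; rewrite !ffunE. Qed.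

HB.instance Definition _ u :=
  GRing.isLinear.Build R[i] (CV F R J) (CV F R J) _ (lmul u) (lmul_is_linear u).

Lemma unit1D_mul u X : u \in UJ F J -> X \in UJ F J -> u *m X - 1%:M \in VJ F J.
Proof. by move=> uU XU; have := UJM J_cc uU XU; rewrite inE. Qed.

Lemma lmul_inj u : u \in UJ F J -> injective (lmul u).
Proof.
move=> uU f1 f2 /ffunP e; apply/ffunP => B; have vU := UJV J_cc uU.
have := e (toV J (invmx u *m (1%:M + val B) - 1%:M)); rewrite !ffunE.
rewrite toVK ?unit1D_mul ?unit1DVJ // subrKC mulKVmx ?(UJ_unit J_cc uU) //.
by rewrite addrAC subrr add0r valK_toV.
Qed.

Lemma lmul_mact u g f : u \in UJ F J -> g \in UJ F J ->
  lmul u (mact g f) = mact g (lmul u f).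
Proof.
move=> uU gU; apply/ffunP => B; rewrite !ffunE !toVK; last 2 first.
- have := unit1D_mul (unit1DVJ B) (UJV J_cc gU).
  by rewrite mulmxDl mul1mx addrAC addrC addrA.
- exact: unit1D_mul (unit1DVJ B).
congr (f (toV J _)); rewrite addrA mulmxBl mul1mx addrNK.
rewrite -mulmxA mulmxDl mul1mx; congr (_ *m _ - _).
by rewrite [RHS]addrC addKr addrC.
Qed.

Lemma lmul_lid u X : u \in UJ F J -> X \in VJ F J ->
  lmul u (lid X) = lid X (toV J (u - 1%:M)) *: lact (invmx u) (lid X).
Proof.
move=> uU XV; apply/ffunP => B; rewrite scale_CV ffunE [lact _ _ B]ffunE invmxK.
rewrite -(lidDr theta_char) ?(mulUJ_VJ J_cc) ?(valP B) //; last by rewrite inE in uU.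
by rewrite mulmxDr mulmx1 addrAC.
Qed.

(** If $[C]=u.[A].w$, then [lmul u] removes the left factor up to scalars. These are nonzero values
    of characters, so one spanning orbit goes to nonzero multiples of the other. *)
Lemma orbbi_CU_iso C A : C \in VJ F J -> A \in VJ F J ->
  lid C \in orbbi theta J A -> CU_iso <<orbr theta J C>> <<orbr theta J A>>.
Proof.
move=> CV0 AV /orbbiP[u [w [uU wU Ce]]].
pose phi := linfun (lmul u).
have phiE f : phi f = lmul u f by rewrite lfunE.
exists phi; split=> [|f1 f2 _ _|f g _ gU]; last 2 first.
- by rewrite !phiE => /lmul_inj; apply.
- by rewrite !phiE lmul_mact.
have phi_ract g : g \in UJ F J -> exists2 c, c != 0 &
    phi (ract g (lid C)) = c *: ract (w *m g) (lid A).
  move=> gU; exists (lid (ractm J g C) (toV J (u - 1%:M))); first exact: lid_neq0.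
  have e : lact (invmx u) (ract g (lid C)) = ract (w *m g) (lid A).
    by rewrite (lract_comm J_cc) ?(UJV J_cc) // Ce lactK // (ract_comp J_cc).
  have GV : ractm J g C \in VJ F J by exact: piJ_VJ.
  have gE := ract_lid theta J_cc CV0 gU.
  by rewrite phiE gE (lmul_lid uU GV) -gE e.
rewrite limg_span; apply/eqP; rewrite eqEsubv; apply/andP; split.
  apply/span_subvP => _ /mapP[_ /orbrP[g gU ->] ->].
  have [c _ ->] := phi_ract g gU; apply/memvZ/memv_span/orbrP.
  by exists (w *m g); rewrite ?(UJM J_cc).
apply/span_subvP => _ /orbrP[h hU ->].
have gU : invmx w *m h \in UJ F J by rewrite UJM ?UJV.
have [c c0] := phi_ract _ gU; rewrite mulKVmx ?(UJ_unit J_cc wU) // => e.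
rewrite -[ract h _](scalerK c0) -e; apply/memvZ/memv_span/map_f/orbrP.
by exists (invmx w *m h).
Qed.

End CUIsomorphism.

(** * The square system attached to the index sets *)

Section IndexSets.

Variables (F : finFieldType) (n : nat) (J : {set 'I_n * 'I_n}).
Hypothesis J_cc : column_closed J.
Implicit Types (a b c i k t h : 'I_n) (X Z C : 'M[F]_n) (S M D : {set 'I_n}).

Lemma main_Gamma_main X a b y : y \in main_Gamma J X a b -> y \in mainc X.
Proof. by rewrite inE => /andP[]. Qed.

Lemma main_Gamma_right X a b y : y \in main_Gamma J X a b -> (b < y.2)%N.
Proof. by rewrite inE => /and5P[]. Qed.

Lemma main_Gamma_fst X a b : rook (mainc X) ->
  {in main_Gamma J X a b &, injective (@fst 'I_n 'I_n)}.
Proof.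
move=> rX [c d] [c' d'] /main_Gamma_main cd /main_Gamma_main cd' /= e.
by rewrite -e in cd' *; rewrite (rX _ _ _ cd cd').
Qed.

Lemma main_Gamma_snd X a b :
  {in main_Gamma J X a b &, injective (@snd 'I_n 'I_n)}.
Proof.
move=> [c d] [c' d'] /main_Gamma_main cd /main_Gamma_main cd' /= e.
by rewrite -e in cd' *; rewrite (mainc_col cd cd').
Qed.

(** This lets the iteration, which runs from left to right, reuse at each column the index sets
    chosen for the initial template. *)
Lemma index_sets_congr X Z a b S M : mainc Z = mainc X ->
  (forall t c, (b < c)%N -> Z t c = X t c) ->
  index_sets J X a b S M -> index_sets J Z a b S M.
Proof.
move=> mZX ZX; have GE : main_Gamma J Z a b = main_Gamma J X a b.
  by rewrite /main_Gamma mZX.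
have sE (T D : {set 'I_n}) : (forall c, c \in D -> (b < c)%N) ->
    submat T D Z = submat T D X.
  by move=> Db; apply/matrixP => i k; rewrite !mxE ZX // Db // enum_valP.
rewrite /index_sets /tcols /nrows /nnrows GE !sE //.

  by move=> c /imsetP[y] + ->; rewrite inE => /andP[/main_Gamma_right].
all: by move=> c /imsetP[y /main_Gamma_right] + ->.
Qed.

(** The rows $\mathcal F$ of $\tilde A(a,b)$ form an invertible square matrix, and the normal ones
    among them span all rows of $B$. Rows in [M] have a single nonzero entry on the columns of
    $\tilde A(a,b)$, their main one; the other columns are independent on the rows [RS] by the rank
    condition. *)
Lemma index_setsP X a b S M : normal_template J X -> index_sets J X a b S M ->
  let G := main_Gamma J X a b in let RS := nrows J X a b :|: S in
  [/\ forall w : 'I_n * 'I_n -> F, (forall t, t \in RS :|: M ->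
        \sum_(y in G) w y * X t y.2 = 0) -> forall y, y \in G -> w y = 0,
      forall e : 'I_n -> F, exists w : 'I_n * 'I_n -> F,
        forall t, t \in RS :|: M -> \sum_(y in G) w y * X t y.2 = e t,
      forall e : 'I_n * 'I_n -> F, exists lam : 'I_n -> F,
        forall y, y \in G -> \sum_(t in RS :|: M) lam t * X t y.2 = e y
    & forall t, t \in Brows J a b -> exists lam : 'I_n -> F,
        forall y, y \in G -> X t y.2 = \sum_(h in RS) lam h * X h y.2].
Proof.
move=> /(normal_templateP J_cc)[XT XN] IS G RS.
have rX := template_rook XT; have XV := template_VJ XT.
case: IS => [[SB RSd MN] [free eqB cD rk]].
have RSn t : t \in RS -> normal_row J t.
  rewrite inE => /orP[/imsetP[y]|/(subsetP SB)]; last by rewrite inE => /and3P[].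
  by rewrite inE => /andP[_ ny ->].
have Mnn t : t \in M -> ~~ normal_row J t.
  by move=> /(subsetP MN)/imsetP[y]; rewrite inE => /andP[_ ny ->].
pose K := [set y in G | y.1 \notin M]; pose D := [set y.2 | y in K].
have DE : [set x.2 | x in G & x.1 \notin M] = D.
  by apply/setP => c; apply/imsetP/imsetP => -[y yK ->]; exists y; rewrite // ?inE in yK *.
rewrite DE in cD rk.
have KG y : y \in K -> y \in G by rewrite inE => /andP[].
have cRS : #|RS| = #|D| by rewrite cD -eqB (eqP free).
have cK : #|D| = #|K|.
  by rewrite card_in_imset // => y z /KG yG /KG zG; apply: main_Gamma_snd yG zG.
have cM : #|M| = #|[set y in G | y.1 \in M]|.
  rewrite -(card_in_imset (f := @fst 'I_n 'I_n)); last first.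
    by move=> y z /setIdP[yG _] /setIdP[zG _]; exact: (main_Gamma_fst rX yG zG).
  congr #|pred_of_set _|; apply/setP => t; apply/idP/imsetP => [tM|[y]]; last first.
    by rewrite inE => /andP[_ yM] ->.
  have /imsetP[y] := subsetP MN t tM; rewrite inE => /andP[yG _] ty.
  by exists y; rewrite // inE yG -ty.
(* [RS] is as large as [K] by the rank conditions, and [M] matches the main conditions outside
   [K]. *)
have cF : #|RS :|: M| = #|G|.
  rewrite cardsU (_ : RS :&: M = set0) ?cards0 ?subn0; last first.
    apply/setP => t; rewrite !inE; apply/negbTE/negP => /andP[tRS /Mnn/negP]; apply.
    by apply: RSn; rewrite inE.
  rewrite cRS cK cM -cardsUI [X in (_ + X)%N](_ : _ = 0%N) ?addn0; last first.
    by apply/eqP; rewrite cards_eq0; apply/eqP/setP => y; rewrite !inE; case: (y.1 \in M); rewrite ?andbF.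
  congr #|pred_of_set _|; apply/setP => y; rewrite !inE.
  by case: (y.1 \in M); rewrite ?andbF ?andbT ?orbF.
have inj (w : 'I_n * 'I_n -> F) : (forall t, t \in RS :|: M ->
    \sum_(y in G) w y * X t y.2 = 0) -> forall y, y \in G -> w y = 0.
  move=> w0.
  (* In a non-normal row a normal template has at most its main entry, so the equation of that row
     contains only [w y]. *)
  have wM y : y \in G -> y.1 \in M -> w y = 0.
    move=> yG yM; have := w0 y.1; rewrite inE yM orbT => /(_ isT).
    rewrite (bigD1 y) //= big1 ?addr0 => [/eqP|z /andP[zG zy]].
      rewrite mulf_eq0 => /orP[/eqP//|]; have := main_Gamma_main yG.
      by case: (y) => c d /mainc_neq0/negPf ->.
    have [->|Xz] := eqVneq (X y.1 z.2) 0; first by rewrite mulr0.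
    have := XN _ _ (Mnn _ yM) Xz; case: (y) (z) (main_Gamma_main yG) (main_Gamma_main zG) zy.
    move=> c d [c' d'] /= cd cd' ne cd''; case/eqP: ne.
    by rewrite (mainc_col cd' cd'') (rX _ _ _ cd cd'').
  (* Reindexing by columns: each column in [D] belongs to exactly one [y] in [K]. *)
  pose w' c := \sum_(y in K | y.2 == c) w y.
  pose v : 'cV[F]_#|D| := \col_j w' (enum_val j).
  have v0 : v = 0.
    have Nv : submat RS D X *m v = 0.
      apply/colP => i; rewrite !mxE.
      transitivity (\sum_(c in D) w' c * X (enum_val i) c).
        by rewrite [RHS]big_enum_val; apply: eq_bigr => j _; rewrite !mxE mulrC.
      rewrite -[RHS](w0 (enum_val i)); last by rewrite inE (enum_valP i).
      rewrite [RHS](bigID (fun y : 'I_n * 'I_n => y.1 \in M)) /=.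
      rewrite [X in _ = X + _]big1 ?add0r => [|y /andP[yG yM]]; last by rewrite wM ?mul0r.
      rewrite [RHS](partition_big snd (mem D)) => [|y yK]; last first.
        by apply: imset_f; rewrite inE.
      apply: eq_bigr => c _; rewrite mulr_suml; apply: eq_big => [y|y /andP[_ /eqP->//]].
      by rewrite inE.
    have full : row_full (submat RS D X) by rewrite /row_full rk.
    by rewrite -[v]mul1mx -(mulVpmx full) -mulmxA Nv mulmx0.
  move=> y yG; have [|yM] := boolP (y.1 \in M); first exact: wM.
  have yK : y \in K by rewrite inE yG.
  have yD : y.2 \in D by apply: imset_f.
  move/colP/(_ (enum_rank_in yD y.2)): v0; rewrite !mxE enum_rankK_in //.
  rewrite /w' (big_pred1 y) // => z /=; apply/andP/eqP => [[zK /eqP e]|->//].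
  exact: main_Gamma_snd (KG _ zK) yG e.
have [sol1 sol2] := square_system cF inj.
split=> // t tB; have /submxP[v rv] : (row (enum_rank_in tB t)
    (submat (Brows J a b) (tcols J X a b) X) <= submat RS (tcols J X a b) X)%MS.
  by rewrite eqB row_sub.
exists (fun h => \sum_(k < #|RS| | enum_val k == h) v 0 k) => y yG.
have yD : y.2 \in tcols J X a b by apply: imset_f.
move/rowP/(_ (enum_rank_in yD y.2)): rv; rewrite !mxE !enum_rankK_in // => ->.
rewrite [RHS]big_enum_val; apply: eq_bigr => k _; rewrite !mxE enum_rankK_in //.
by congr (_ * _); rewrite (big_pred1 k) // => j /=; rewrite (inj_eq enum_val_inj).
Qed.

End IndexSets.

(** * Existence and uniqueness of $[A^v]$ *)

Section NormalizedSteps.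

Variables (F : finFieldType) (n : nat) (J : {set 'I_n * 'I_n}).
Hypothesis J_cc : column_closed J.
Variables (R : realType) (theta : F -> R[i]).
Hypothesis theta_char : nontrivial_character theta.
Implicit Types (a b c i k t h : 'I_n) (X Z C : 'M[F]_n) (S M : {set 'I_n}).

Lemma index_sets_rows X a b S M : index_sets J X a b S M ->
  [/\ forall t, t \in nrows J X a b :|: S :|: M -> (a < t)%N /\ (t < b)%N,
      forall t, t \in nrows J X a b :|: S -> normal_row J t,
      [disjoint nrows J X a b & S :|: M],
      forall t c, (t, c) \in mainc X -> (t, c) \in J -> (a < t)%N -> (t < b)%N ->
        (b < c)%N -> normal_row J t -> t \in nrows J X a b
    & forall t, t \in nrows J X a b -> exists2 c, (t, c) \in mainc X & (b < c)%N].
Proof.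
case=> -[SB RS MN] _.
have SP t : t \in S -> [/\ (a < t)%N, (t < b)%N & normal_row J t].
  by move/(subsetP SB); rewrite inE => /and3P.
have RP t : t \in nrows J X a b -> [/\ (a < t)%N, (t < b)%N, normal_row J t
    & exists2 c, (t, c) \in mainc X & (b < c)%N].
  case/imsetP=> -[r c] /setIdP[/setIdP[rc /and4P[/= _ ar rb bc]] nr] ->.
  by split=> //; exists c.
have MP t : t \in M -> [/\ (a < t)%N, (t < b)%N & ~~ normal_row J t].
  by move/(subsetP MN)/imsetP=> -[[r c] /setIdP[/setIdP[rc /and4P[/= _ ar rb bc]] nr] ->].
split=> [t|t|||t /RP[]//].
- by rewrite !in_setU => /orP[/orP[/RP[]|/SP[]]|/MP[]].
- by rewrite in_setU => /orP[/RP[]|/SP[]].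
- apply/pred0P => t /=; apply/negP => /andP[tR]; rewrite in_setU.
  case/orP=> [tS|/MP[_ _]]; first by rewrite (disjointFr RS tR) in tS.
  by case/RP: tR => _ _ ->.
- move=> t c tc tcJ at_ tb bc nt; apply/imsetP; exists (t, c) => //.
  by apply/setIdP; split=> //; apply/setIdP; split=> //; apply/and4P.
Qed.

Lemma gamma_sum_congr X Z a b (w : 'I_n * 'I_n -> F) t : mainc Z = mainc X ->
  (forall c, (b < c)%N -> Z t c = X t c) ->
  gamma_sum J Z a b w t = gamma_sum J X a b w t.
Proof.
move=> mZX ZX; rewrite /gamma_sum.
have -> : main_Gamma J Z a b = main_Gamma J X a b by rewrite /main_Gamma mZX.
by apply: eq_bigr => y /main_Gamma_right /ZX ->.
Qed.

Lemma gamma_sumB X a b (w w' : 'I_n * 'I_n -> F) t :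
  gamma_sum J X a b (fun y => w y - w' y) t =
  gamma_sum J X a b w t - gamma_sum J X a b w' t.
Proof. by rewrite /gamma_sum -sumrB; apply: eq_bigr => y _; rewrite mulrBl. Qed.

(* The rows of nrows :|: S span the row space of B. *)
Lemma gamma_sum_normal X a b S M (w : 'I_n * 'I_n -> F) :
  normal_template J X -> index_sets J X a b S M ->
  (forall h, h \in nrows J X a b :|: S -> gamma_sum J X a b w h = 0) ->
  forall t, normal_row J t -> (t < b)%N -> gamma_sum J X a b w t = 0.
Proof.
move=> XN IS w0 t nt tb; have [ta|at_] := leqP t a.
  by apply: gamma_sum0 ta; apply: template_VJ; case/(normal_templateP J_cc): XN.
have [_ _ _ /(_ t)] := index_setsP J_cc XN IS.
rewrite inE at_ tb nt => /(_ isT)[lam lamP].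
rewrite /gamma_sum; under eq_bigr => y yG do rewrite lamP // mulr_sumr.
rewrite exchange_big big1 //= => h hRS.
transitivity (lam h * gamma_sum J X a b w h); last by rewrite w0 ?mulr0.
by rewrite /gamma_sum mulr_sumr; apply: eq_bigr => y _; apply: mulrCA.
Qed.

(** Solving the square system on the rows $\mathcal F$ gives a column with the prescribed entries.
    The resulting matrix satisfies [is_Av] and is the only one that does, so the [pick] in [Av]
    returns it. *)
Lemma AvP X a b S M v : normal_template J X -> (a, b) \in mainc X ->
  index_sets J X a b S M ->
  let Z := Av theta J X a b S M v in exists w : 'I_n * 'I_n -> F,
  [/\ forall t, (t < b)%N -> Z t b = X t b + gamma_sum J X a b w t,
      forall t c, c != b -> Z t c = X t c,
      Z \in VJ F J,
      forall h, h \in S :|: M -> Z h b = v h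
    & forall h, h \in nrows J X a b -> Z h b = 0].
Proof.
move=> XN ab IS /=; have /(normal_templateP J_cc)[XT _] := XN.
have XV := template_VJ XT; have abJ := VJ_neq0 XV (mainc_neq0 ab).
have [rowsFF _ disj _ _] := index_sets_rows IS.
have [_ sol lsol _] := index_setsP J_cc XN IS.
(* The required change of column [b] in the rows $\mathcal F$. *)
pose e t := (if t \in S :|: M then v t else 0) - X t b.
have {sol} [w wP] := sol e.
pose W : 'M[F]_n := \matrix_(t, c)
  (if (c == b) && (t < b)%N then X t b + gamma_sum J X a b w t else X t c).
have WE t : (t < b)%N -> W t b = X t b + gamma_sum J X a b w t.
  by move=> tb; rewrite mxE eqxx tb.
have Wc t c : c != b -> W t c = X t c by move=> /negPf cb; rewrite mxE cb.
have WV : W \in VJ F J.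
  apply/VJP => t c tc; rewrite mxE; case: ifP => [/andP[/eqP cb tb]|_]; last exact: VJ0 XV tc.
  by rewrite cb (J_above J_cc abJ tb) in tc.
have WFF t : t \in nrows J X a b :|: S :|: M ->
    W t b = if t \in S :|: M then v t else 0.
  by move=> tFF; have [_ tb] := rowsFF t tFF; rewrite WE // [gamma_sum _ _ _ _ _ _]wP // /e subrKC.
have WSM h : h \in S :|: M -> W h b = v h.
  by move=> hSM; rewrite WFF ?hSM // -setUA inE hSM orbT.
have Wn h : h \in nrows J X a b -> W h b = 0.
  move=> hn; rewrite WFF ?inE ?hn //.
  by have := disjointFr disj hn; rewrite inE => ->.
have Wis : is_Av theta J X a b S M v W.
  rewrite /is_Av WV /=; apply/and5P; split.
  - apply/lid_orbr => //; apply: rrel_intro => // c.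
    have [->|cb] := eqVneq c b; [right; by exists a, w|left=> t; exact: Wc].
  - apply/forallP => -[t c]; apply/implyP; rewrite inE /= => tc; apply/eqP.
    rewrite mxE; case: ifP => // /andP[/eqP cb tb]; move: tc.
    by rewrite cb eqxx tb !andbT -leqNgt => ta; rewrite gamma_sum0 ?addr0.
  - by apply/forall_inP => h /Wn ->.
  - by apply/forall_inP => h /WSM ->.
  - apply/forallP => t; apply/implyP => /and3P[at_ tb tFF].
    apply/forallP => lam; apply/implyP => /forall_inP lamP; apply/eqP.
    rewrite WE //; congr (_ + _); rewrite /gamma_sum.
    transitivity (\sum_(h in nrows J X a b :|: S :|: M)
        lam h * \sum_(y in main_Gamma J X a b) w y * X h y.2).
      under [RHS]eq_bigr => h _ do rewrite mulr_sumr.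
      rewrite exchange_big; apply: eq_bigr => y yG /=.
      rewrite (eqP (lamP _ (imset_f _ yG))) mulr_sumr; apply: eq_bigr => h _.
      exact: mulrCA.
    apply: eq_bigr => h hFF; have [_ hb] := rowsFF h hFF.
    by rewrite WE // addrC addKr.
(* By [lsol] every row of the leg outside $\mathcal F$ is a combination of the rows $\mathcal F$ on
   the columns of $\tilde A(a,b)$, so the last clause of [is_Av] determines its entry. *)
have uniq Z : is_Av theta J X a b S M v Z -> Z = W.
  case/and5P: Wis => _ _ /forallP W1 /forall_inP W2 /andP[/forall_inP W3 /forallP W4].
  case/and5P=> _ _ /forallP Z1 /forall_inP Z2 /andP[/forall_inP Z3 /forallP Z4].
  have ZFF t : t \in nrows J X a b :|: S :|: M -> Z t b = W t b.
    rewrite -setUA in_setU => /orP[tR|tSM].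
      by rewrite (eqP (W2 t tR)) (eqP (Z2 t tR)).
    by rewrite (eqP (W3 t tSM)) (eqP (Z3 t tSM)).
  apply/matrixP => t c; have [leg|leg] := boolP ((t, c) \in hook_leg a b); last first.
    by have /implyP/(_ leg)/eqP/= -> := Z1 (t, c); have /implyP/(_ leg)/eqP/= -> := W1 (t, c).
  move: leg; rewrite inE /= => /and3P[at_ tb /eqP ->].
  have [|tFF] := boolP (t \in nrows J X a b :|: S :|: M); first exact: ZFF.
  have [lam lamP] := lsol (fun y => X t y.2).
  have lamP' : [forall c in tcols J X a b, X t c ==
      \sum_(h in nrows J X a b :|: S :|: M) [ffun h => lam h] h * X h c].
    apply/forall_inP => d /imsetP[y yG ->]; rewrite -(lamP y yG); apply/eqP.
    by apply: eq_bigr => h _; rewrite ffunE.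
  have H : [&& (a < t)%N, (t < b)%N & t \notin nrows J X a b :|: S :|: M] by apply/and3P.
  have /implyP/(_ H)/forallP/(_ [ffun h => lam h])/implyP/(_ lamP')/eqP -> := Z4 t.
  have /implyP/(_ H)/forallP/(_ [ffun h => lam h])/implyP/(_ lamP')/eqP -> := W4 t.
  by congr (_ + _); apply: eq_bigr => h hFF; rewrite ZFF.
exists w; rewrite /Av; case: pickP => [Z /uniq -> /=|/(_ W)]; last by rewrite Wis.
by split.
Qed.

End NormalizedSteps.

Lemma vecsP (F : finFieldType) (K : finType) (T : {set K}) (v : {ffun K -> F}) :
  reflect (forall x, x \notin T -> v x = 0) (v \in vecs F T).
Proof.
rewrite inE; apply: (iffP forallP) => H x; first by move=> xT; apply/eqP; apply: implyP xT.
by apply/implyP => /H ->.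
Qed.

(** * The iterated construction and the family of templates *)

Section Iterates.

Variables (F : finFieldType) (n : nat) (J : {set 'I_n * 'I_n}).
Hypothesis J_cc : column_closed J.
Variables (R : realType) (theta : F -> R[i]).
Hypothesis theta_char : nontrivial_character theta.
Variables (A : 'M[F]_n) (m : nat) (ii jj : 'I_m -> 'I_n).
Hypothesis A_nt : normal_template J A.
Hypothesis main_A : mainc A = [set (ii s, jj s) | s : 'I_m].
Hypothesis jj_incr : forall s t : 'I_m, (s < t)%N -> (jj s < jj t)%N.
Variables SS MM : 'I_m -> {set 'I_n}.
Hypothesis SM : forall s, index_sets J A (ii s) (jj s) (SS s) (MM s).
Variable y : 'M[F]_n -> 'I_m -> {ffun 'I_n -> F} -> 'M[F]_n.
Hypothesis y_ok : y_choice theta J ii jj SS MM y.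
Implicit Types (a b c i k t h : 'I_n) (X Z C : 'M[F]_n) (r s : 'I_m).
Implicit Types (w : 'I_n * 'I_n -> F).

Local Notation Y := (YpJ (mainc A) J).
Local Notation gam s := (gamma_sum J A (ii s) (jj s)).

Lemma main_mem s : (ii s, jj s) \in mainc A.
Proof. by rewrite main_A imset_f. Qed.

Lemma main_index a b : (a, b) \in mainc A -> exists s, a = ii s /\ b = jj s.
Proof. by rewrite main_A => /imsetP[s _ [-> ->]]; exists s. Qed.

Lemma jj_inj : injective jj.
Proof.
move=> r s e; apply: ord_inj; case: (ltngtP r s) => // /jj_incr;
by rewrite e ltnn.
Qed.

Lemma A_template : template J A.
Proof. by case/andP: A_nt. Qed.

Lemma A_VJ : A \in VJ F J.
Proof. exact: template_VJ A_template. Qed.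

Lemma nonmain_col X t c : mainc X = mainc A -> (forall s, c != jj s) -> X t c = 0.
Proof.
move=> mX cj; apply/eqP; case: eqVneq => // /mainc_ex[a].
by rewrite mX => /main_index[s [_ /eqP]]; rewrite (negPf (cj s)).
Qed.

Lemma mainJ s t : (t < jj s)%N -> (t, jj s) \in J.
Proof. by apply: J_above => //; apply: VJ_neq0 A_VJ (mainc_neq0 (main_mem s)). Qed.

Lemma gam_above s w t : (t <= ii s)%N -> gam s w t = 0.
Proof. exact: gamma_sum0 A_VJ. Qed.

Lemma SS_normal s h : h \in SS s ->
  [/\ (ii s < h)%N, (h < jj s)%N & normal_row J h].
Proof.
move=> hS; have [rows norm _ _ _] := index_sets_rows (SM s).
have [] := rows h; first by rewrite !in_setU hS orbT.
by split=> //; apply: norm; rewrite in_setU hS orbT.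
Qed.

Lemma normal_zero s w : (forall h, h \in nrows J A (ii s) (jj s) :|: SS s ->
  gam s w h = 0) -> forall t, normal_row J t -> (t < jj s)%N -> gam s w t = 0.
Proof. exact: (gamma_sum_normal J_cc A_nt (SM s)). Qed.

Lemma nrows_template X s h : template J X -> mainc X = mainc A ->
  h \in nrows J A (ii s) (jj s) -> X h (jj s) = 0.
Proof.
move=> XT mX hR; have [_ _ _ _ /(_ h hR)[c hc]] := index_sets_rows (SM s).
by apply: template_left XT _; rewrite mX.
Qed.

Section Step.

Variables (X : 'M[F]_n) (s : 'I_m) (v : {ffun 'I_n -> F}).
Hypotheses (X_nt : normal_template J X) (mX : mainc X = mainc A).
Hypothesis X_right : forall t c, (jj s < c)%N -> X t c = A t c.

Local Notation Z := (Avs theta J ii jj SS MM X s v).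

Lemma Avs_spec : exists w,
  [/\ forall t, (t < jj s)%N -> Z t (jj s) = X t (jj s) + gam s w t,
      forall t c, c != jj s -> Z t c = X t c,
      Z \in VJ F J,
      forall h, h \in SS s :|: MM s -> Z h (jj s) = v h
    & forall h, h \in nrows J A (ii s) (jj s) -> Z h (jj s) = 0].
Proof.
have IS : index_sets J X (ii s) (jj s) (SS s) (MM s).
  exact: index_sets_congr mX X_right (SM s).
have mem : (ii s, jj s) \in mainc X by rewrite mX main_mem.
have [w [H1 H2 H3 H4 H5]] := AvP J_cc theta_char v X_nt mem IS.
exists w; split=> // [t tb|h]; last first.
  by move=> hR; apply: H5; move: hR; rewrite /nrows /main_Gamma mX.
by rewrite H1 //; congr (_ + _); apply: gamma_sum_congr mX _ => c; apply: X_right.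
Qed.

Lemma Avs_mainc : mainc Z = mainc X.
Proof.
have [w [Zb Zc ZV _ _]] := Avs_spec; apply: eq_mainc => [t c|a c ac].
  have [->|cb] := eqVneq c (jj s); last by rewrite Zc //; apply: mainc_ex.
  move=> Ztb; exists (ii s); first by rewrite mX main_mem.
  rewrite leqNgt; apply: contraNN Ztb => ta.
  rewrite Zb ?gam_above ?(ltnW ta) ?(ltn_trans ta) ?(J_lt J_cc) //; last first.
    exact: VJ_neq0 A_VJ (mainc_neq0 (main_mem s)).
  by rewrite addr0 (mainc_above (a := ii s)) // mX main_mem.
have [cb|cb] := eqVneq c (jj s); last by rewrite Zc // mainc_neq0.
have := ac; rewrite cb mX => /(mainc_col (main_mem s)) <-.
rewrite Zb ?gam_above ?(J_lt J_cc) ?addr0 //.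
  by rewrite mainc_neq0 // mX main_mem.
exact: VJ_neq0 A_VJ (mainc_neq0 (main_mem s)).
Qed.

(** [T] keeps the new entries of column [jj s] in normal rows and the old ones elsewhere. It is a
    normal template in the left orbit of $[X^v]$, so by uniqueness every admissible $y_v$ produces
    it. *)
Lemma Astep_spec :
  let T := Astep theta J ii jj SS MM y X s v in
  [/\ y X s v \in UJ F J, normal_template J T, mainc T = mainc X,
      forall t c, c != jj s -> T t c = X t c
    & exists w, (forall t, T t (jj s) = X t (jj s) +
         (if normal_row J t && (t < jj s)%N then gam s w t else 0)) /\
       forall h, h \in SS s -> T h (jj s) = v h].
Proof.
have [w [Zb Zc ZV ZSM ZR]] := Avs_spec; have mZ := Avs_mainc.
have /(normal_templateP J_cc)[XT XN] := X_nt; have XV := template_VJ XT.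
pose T : 'M[F]_n := \matrix_(t, c)
  (if (c == jj s) && normal_row J t then Z t c else X t c).
have TV : T \in VJ F J.
  by apply/VJP => t c tc; rewrite mxE (VJ0 ZV tc) (VJ0 XV tc) if_same.
have ZT : lrel J Z T.
  apply: (lrel_intro J_cc ZV TV) => [|t c]; first by rewrite mZ; apply: template_rook XT.
  rewrite mxE; case: (eqVneq c (jj s)) => [->|cb] /=; last by rewrite Zc // eqxx.
  case: ifPn => [_|nt XZ]; first by rewrite eqxx.
  split=> //; exists (ii s); first by rewrite mZ mX main_mem.
  rewrite ltnNge; apply: contraNN XZ => ta; rewrite Zb ?gam_above ?addr0 //.
  exact: leq_ltn_trans ta (J_lt J_cc (VJ_neq0 A_VJ (mainc_neq0 (main_mem s)))).
have mT : mainc T = mainc X by rewrite (lrel_mainc J_cc ZV ZT).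
have TT : normal_template J T.
  apply/(normal_templateP J_cc); split=> [|t c nt]; last first.
    by rewrite mxE (negPf nt) andbF mT; apply: XN.
  apply: templateP => // r d k; rewrite mT => rd kd; rewrite mxE.
  have Xrk := template_left XT rd kd.
  case: ifP => [/andP[/eqP kb nr]|//]; rewrite {}kb in kd Xrk *.
  (* The row [r] of a main condition further right: at or above [ii s] nothing has changed; between
     [ii s] and [jj s] it belongs to [nrows], where the new entry is 0. *)
  have [rb|br] := ltnP r (jj s); last first.
    by apply: VJ0 ZV _; apply/negP => /(J_lt J_cc); rewrite ltnNge br.
  have [ra|ar] := leqP r (ii s); first by rewrite Zb // gam_above ?addr0.
  apply: ZR; have [_ _ _ H _] := index_sets_rows (SM s).
  rewrite mX in rd; apply: (H r d) => //.
  exact: VJ_neq0 A_VJ (mainc_neq0 rd).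
have [u uU Tu] := ZT.
have /y_ok/andP[yU yN] : normalizes theta J ii jj SS MM X s v u.
  by rewrite /normalizes uU -Tu.
have -> : Astep theta J ii jj SS MM y X s v = T.
  apply: (lrel_normal_template J_cc ZV) => //.
  by exists (y X s v).
split=> // [t c cb|]; first by rewrite mxE (negPf cb).
exists w; split=> [t|h hS]; last first.
  have [_ _ nh] := SS_normal hS.
  by rewrite mxE eqxx nh ZSM // in_setU hS.
rewrite mxE eqxx /=; case: (normal_row J t); last by rewrite addr0.
case: ltnP => [|bt] /=; first exact: Zb.
by rewrite addr0 !(VJ0 _ (_ : (t, jj s) \notin J)) //; apply/negP => /(J_lt J_cc);
   rewrite ltnNge bt.
Qed.

End Step.

Definition column_spec (T : 'M[F]_n) s (v : {ffun 'I_n -> F}) : Prop :=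
  exists w, (forall t, T t (jj s) = A t (jj s) +
      (if normal_row J t && (t < jj s)%N then gam s w t else 0)) /\
    forall h, h \in SS s -> T h (jj s) = v h.

(** Stated for any increasing list of steps and any start [X] so that induction applies: a step
    changes only its own column, so the columns still to come agree with [A] and finished ones stay
    as they are. *)
Lemma foldl_Astep (l : seq 'I_m) X (v : {ffun 'I_m -> {ffun 'I_n -> F}}) :
  sorted (fun s t : 'I_m => (s < t)%N) l ->
  normal_template J X -> mainc X = mainc A ->
  (forall s, s \in l -> forall t c, (jj s <= c)%N -> X t c = A t c) ->
  let T := foldl (fun X s => Astep theta J ii jj SS MM y X s (v s)) X l in
  [/\ normal_template J T, mainc T = mainc A,
      forall t c, (forall s, s \in l -> c != jj s) -> T t c = X t c
    & forall s, s \in l -> column_spec T s (v s)].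
Proof.
elim: l X => [|s l IH] X /=; first by split.
rewrite (path_sortedE (fun r p q => @ltn_trans r p q)) => /andP[/allP sl sort_l] XN mX XA.
have Xr t c : (jj s < c)%N -> X t c = A t c.
  by move/ltnW; apply: XA; rewrite mem_head.
have [_ TN mT Tc [w [Tb TS]]] := Astep_spec (v s) XN mX Xr.
set X1 := Astep _ _ _ _ _ _ _ _ _ _ in TN mT Tc Tb TS *.
have jlt r : r \in l -> (jj s < jj r)%N by move/sl/jj_incr.
have mX1 : mainc X1 = mainc A by rewrite mT.
have [|N1 N2 N3 N4] := IH X1 sort_l TN mX1.
  move=> r rl t c rc; rewrite Tc; first by apply: XA rc; rewrite in_cons rl orbT.
  by rewrite -val_eqE gtn_eqF // (leq_trans (jlt r rl)).
split=> // [t c cl|r].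
  rewrite N3 => [|r rl]; last by apply: cl; rewrite in_cons rl orbT.
  by rewrite Tc // cl // mem_head.
rewrite in_cons => /predU1P[->|]; last exact: N4.
have same t : foldl (fun X s => Astep theta J ii jj SS MM y X s (v s)) X1 l t (jj s)
    = X1 t (jj s).
  by apply: N3 => q /jlt lt; rewrite -val_eqE ltn_eqF.
exists w; split=> [t|h hS]; rewrite same; last exact: TS.
by rewrite Tb (XA s) // mem_head.
Qed.

Local Notation Aseq := (Aiter theta J ii jj SS MM y A).

Lemma Aiter_spec (v : {ffun 'I_m -> {ffun 'I_n -> F}}) :
  [/\ normal_template J (Aseq v), mainc (Aseq v) = mainc A
    & forall s, column_spec (Aseq v) s (v s)].
Proof.
have sort_m : sorted (fun r s : 'I_m => (r < s)%N) (enum 'I_m).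
  by have := iota_ltn_sorted 0 m; rewrite -val_enum_ord sorted_map.
have [//|N1 N2 _ N4] := @foldl_Astep (enum 'I_m) A v sort_m A_nt (erefl _).
by split=> // s; apply: N4; rewrite mem_enum.
Qed.

Local Notation Sfam := [set v : {ffun 'I_m -> {ffun 'I_n -> F}} |
  [forall s, v s \in vecs F (SS s)]].

Lemma column_nonmain c : (exists s, c = jj s) \/ (forall s, c != jj s).
Proof.
have [/existsP[s /eqP->]|/existsPn H] := boolP [exists s, c == jj s]; last by right.
by left; exists s.
Qed.

(** The difference of the two columns is a combination of columns of $\tilde A(a,b)$. It vanishes in
    the rows of [SS s] by assumption and in [nrows] because both matrices are templates, hence in
    all normal rows. *)
Lemma eq_normal_column C s v w w' (T : 'M[F]_n) :
  template J C -> mainc C = mainc A -> template J T -> mainc T = mainc A ->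
  (forall t, normal_row J t -> (t < jj s)%N -> C t (jj s) = A t (jj s) + gam s w t) ->
  (forall t, normal_row J t -> (t < jj s)%N -> T t (jj s) = A t (jj s) + gam s w' t) ->
  (forall h, h \in SS s -> C h (jj s) = v h) ->
  (forall h, h \in SS s -> T h (jj s) = v h) ->
  forall t, normal_row J t -> (t < jj s)%N -> C t (jj s) = T t (jj s).
Proof.
move=> CT mC TT mT Cw Tw' Cv Tv t nt tb; rewrite Cw // Tw' //; congr (_ + _).
apply/eqP; rewrite -subr_eq0 -gamma_sumB; apply/eqP; apply: normal_zero => // h hRS.
have [rows norm _ _ _] := index_sets_rows (SM s).
have [_ hb] := rows h (subsetP (subsetUl _ _) _ hRS).
apply/eqP; rewrite gamma_sumB subr_eq0.
rewrite -(inj_eq (addrI (A h (jj s)))) -Cw ?norm // -Tw' ?norm //.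
move: hRS; rewrite in_setU => /orP[hR|hS]; last by rewrite Cv ?Tv.
by rewrite !nrows_template.
Qed.

(** The parameters are read off [C]: [L] from its entries on $\mathcal Y$, and [v] from its entries
    in the rows of [SS s] in column [jj s]. *)
Lemma template_in_family C Z : template J C -> mainc C = mainc A ->
  lrel J A Z -> rrel J Z C ->
  exists L v, [/\ L \in vecs F Y, v \in Sfam & C = put Y L (Aseq v)].
Proof.
move=> CT mC AZ ZC; have CV := template_VJ CT.
have ZV := lrel_VJ J_cc A_VJ AZ; have mZ := lrel_mainc J_cc A_VJ AZ.
pose L : {ffun 'I_n * 'I_n -> F} := [ffun x => if x \in Y then C x.1 x.2 else 0].
pose v : {ffun 'I_m -> {ffun 'I_n -> F}} :=
  [ffun s => [ffun h => if h \in SS s then C h (jj s) else 0]].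
exists L, v; split.
- by apply/vecsP => x /negPf xY; rewrite ffunE xY.
- by rewrite inE; apply/forallP => s; apply/vecsP => h /negPf hS; rewrite !ffunE hS.
have [TN mT Tspec] := Aiter_spec v; set T := Aseq v in TN mT Tspec *.
have /(normal_templateP J_cc)[TT TN'] := TN; have TV := template_VJ TT.
apply/matrixP => t c; rewrite mxE ffunE /=; case: ifPn => [-> //|tcY].
have [[s cs]|cN] := column_nonmain c; last by rewrite (nonmain_col t mC cN) (nonmain_col t mT cN).
have [w [Tw Tv]] := Tspec s.
have rZ : rook (mainc Z) by rewrite mZ; apply: template_rook A_template.
have sZ : (ii s, jj s) \in mainc Z by rewrite mZ main_mem.
have C0 i : (i < ii s)%N -> C i (jj s) = 0.
  by apply: mainc_above; rewrite mC main_mem.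
have [w' Cw'] := rrel_gamma J_cc ZV rZ ZC sZ C0.
have [tb|bt] := ltnP t (jj s); last first.
  have tN : (t, c) \notin J by apply/negP => /(J_lt J_cc); rewrite cs ltnNge bt.
  by rewrite (VJ0 CV) ?(VJ0 TV).
rewrite {}cs in tcY *.
(* Non-normal entries off $\mathcal Y$ are main entries, which agree, or zero; normal entries are
   compared by [eq_normal_column]. *)
have [nt|nt] := boolP (normal_row J t); last first.
  have [|tm] := boolP ((t, jj s) \in mainc A).
    move=> tm; rewrite Cw' // Tw (negPf nt) /= addr0 (lrel_main J_cc A_VJ AZ tm).
    by rewrite gamma_sum0 ?addr0 // (mainc_col tm (main_mem s)).
  have C00 : C t (jj s) = 0.
    apply/eqP; apply: contraNT tcY => Ct; rewrite inE nt andbT -mC.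
    by apply: (template_suppl J_cc CT Ct); rewrite mC.
  rewrite C00; apply/esym/eqP; apply: contraNT tm => /TN'; rewrite mT; exact.
apply: (@eq_normal_column C s (v s) w' w) => // {tcY nt tb t} [t nt tb|t nt tb|h hS].
- rewrite Cw' // (lrel_fixed J_cc A_VJ AZ) ?nt //; congr (_ + _).
  apply: gamma_sum_congr mZ _ => c' _.
  by rewrite (lrel_fixed J_cc A_VJ AZ) ?nt.
- by rewrite Tw nt tb.
- by rewrite !ffunE hS.
Qed.

(** The intermediate [W] adds the full combinations to the columns of [A], in non-normal rows as
    well, and is thus in the right orbit of [A]. It differs from [X] only in non-normal rows below
    main conditions, which the left action can adjust. *)
Lemma family_template L (v : {ffun 'I_m -> {ffun 'I_n -> F}}) :
  let X := put Y L (Aseq v) in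
  [/\ template J X, mainc X = mainc A & exists2 W, rrel J A W & lrel J W X].
Proof.
have [TN mT Tspec] := Aiter_spec v; set T := Aseq v in TN mT Tspec *.
have /(normal_templateP J_cc)[TT _] := TN; have TV := template_VJ TT.
set X := put Y L T.
have /fin_all_exists[w Tw] : forall s, exists w, forall t, T t (jj s) =
    A t (jj s) + (if normal_row J t && (t < jj s)%N then gam s w t else 0).
  by move=> s; have [w [H _]] := Tspec s; exists w.
pose W : 'M[F]_n := \matrix_(t, c) (A t c + (if [pick s | jj s == c] is Some s
  then if (t < c)%N then gam s (w s) t else 0 else 0)).
have Ws t s : W t (jj s) = A t (jj s) + (if (t < jj s)%N then gam s (w s) t else 0).
  rewrite mxE; case: pickP => [r /eqP/jj_inj ->//|/(_ s)]; by rewrite eqxx.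
have WN t c : (forall s, c != jj s) -> W t c = 0.
  move=> cN; rewrite mxE (nonmain_col (X := A)) // add0r.
  by case: pickP => // s; rewrite eq_sym (negPf (cN s)).
have WV : W \in VJ F J.
  apply/VJP => t c tc; have [[s cs]|/WN//] := column_nonmain c.
  rewrite {}cs in tc *; rewrite Ws (VJ0 A_VJ tc) add0r; case: ifP => // tb.
  by rewrite mainJ in tc.
have AW : rrel J A W.
  apply: (rrel_intro J_cc A_VJ WV) => c.
  have [[s ->]|cN] := column_nonmain c.
    by right; exists (ii s), (w s) => t tb; rewrite Ws tb.
  by left=> t; rewrite WN // (nonmain_col (X := A)).
have Wle s t : (t <= ii s)%N -> W t (jj s) = A t (jj s).
  by move=> ta; rewrite Ws gam_above // if_same addr0.
have mW : mainc W = mainc A.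
  apply: eq_mainc => [t c Wtc|a b ab]; last first.
    by have [s [as_ bs]] := main_index ab; rewrite bs Wle ?as_ // mainc_neq0 ?main_mem.
  have [[s cs]|cN] := column_nonmain c; last by rewrite WN ?eqxx in Wtc.
  rewrite {}cs in Wtc *; exists (ii s); first exact: main_mem.
  rewrite leqNgt; apply: contraNN Wtc => ta.
  by rewrite Wle ?(ltnW ta) // (mainc_above (main_mem s)).
have YJ t c : (t, c) \in Y -> (t, c) \in J.
  by case/YpJ_P => nt tc [a ac _] _; apply: J_above (VJ_neq0 A_VJ (mainc_neq0 ac)) tc.
have XV : X \in VJ F J.
  apply/VJP => t c tc; rewrite mxE ifF; first exact: VJ0 TV tc.
  by apply: contraNF tc; apply: YJ.
have WX : lrel J W X.
  apply: (lrel_intro J_cc WV XV) => [|t c]; first by rewrite mW; apply: template_rook A_template.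
  rewrite mxE; case: ifPn => [tcY _|tcY].
    by have [nt _ [a ac at_] _] := YpJ_P tcY; rewrite mW; split=> //; exists a.
  have [[s cs]|cN] := column_nonmain c; last by rewrite WN // nonmain_col ?eqxx.
  rewrite {}cs in tcY *; rewrite Tw Ws.
  case: (boolP (normal_row J t)) => [nt|nt] /=; first by rewrite eqxx.
  move=> H; split=> //; exists (ii s); first by rewrite mW main_mem.
  rewrite ltnNge; apply: contraNN H => ta.
  by rewrite gam_above // if_same.
have mX : mainc X = mainc A by rewrite (lrel_mainc J_cc WV WX).
split=> //; last by exists W.
apply: templateP => // a b k; rewrite mX => ab kb; rewrite mxE.
case: ifPn => [/YpJ_P[_ _ _ /(_ b kb)]|_]; first by rewrite ab.
by apply: template_left TT _ kb; rewrite mT.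
Qed.

(** [L] is visible on $\mathcal Y$; [v] is visible in the rows of [SS s], which are normal and hence
    untouched by [L]. *)
Lemma family_inj L L' (v v' : {ffun 'I_m -> {ffun 'I_n -> F}}) :
  L \in vecs F Y -> L' \in vecs F Y -> v \in Sfam -> v' \in Sfam ->
  put Y L (Aseq v) = put Y L' (Aseq v') -> L = L' /\ v = v'.
Proof.
move=> LY LY'; rewrite !inE => /forallP vS /forallP vS' /matrixP e; split.
  apply/ffunP => -[t c]; have [tcY|tcY] := boolP ((t, c) \in Y).
    by have := e t c; rewrite !mxE tcY.
  by rewrite (vecsP _ _ LY) ?(vecsP _ _ LY').
apply/ffunP => s; apply/ffunP => h; have [hS|hS] := boolP (h \in SS s); last first.
  by rewrite (vecsP _ _ (vS s)) ?(vecsP _ _ (vS' s)).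
have [_ _ /(_ s)[w [_ vE]]] := Aiter_spec v.
have [_ _ /(_ s)[w' [_ vE']]] := Aiter_spec v'.
have /negPf hY : (h, jj s) \notin Y.
  by apply/negP => /YpJ_P[/negP + _ _ _]; have [_ _] := SS_normal hS.
by rewrite -vE // -vE' //; have := e h (jj s); rewrite !mxE hY.
Qed.

Local Notation W := (Ws jj SS MM A).
Local Notation refl_right s := (fun t c (_ : (jj s < c)%N) => erefl (A t c)).
Implicit Types v : {ffun 'I_n -> F}.

Lemma WsP s v : reflect ((forall h, h \notin SS s :|: MM s -> v h = 0) /\
  forall h, h \in SS s -> v h = A h (jj s)) (v \in W s).
Proof.
rewrite inE; apply: (iffP andP) => -[/vecsP v0 vA]; split=> //.
  by move=> h hS; apply/eqP; apply: (forall_inP vA).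
by apply/forall_inP => h /vA ->.
Qed.

Lemma WsP_intro s (f : 'I_n -> F) : [ffun h => if h \in SS s then A h (jj s) else
  if h \in MM s then f h else 0] \in W s.
Proof.
apply/WsP; split=> h hS; rewrite ffunE ?hS //.
by move: hS; rewrite in_setU negb_or => /andP[/negPf -> /negPf ->].
Qed.

(** The combination added to column [jj s] vanishes in [SS s] by the choice of [v] and in [nrows]
    because both sides are templates, so it vanishes in all normal rows. *)
Lemma Ws_step s v : v \in W s -> Astep theta J ii jj SS MM y A s v = A.
Proof.
move=> /WsP[_ vA].
have [_ TN mT Tc [w [Tb TS]]] := @Astep_spec A s v A_nt (erefl _) (refl_right s).
set T := Astep _ _ _ _ _ _ _ _ _ _ in TN mT Tc Tb TS *.
have /(normal_templateP J_cc)[TT _] := TN.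
apply/matrixP => t c; have [->|cs] := eqVneq c (jj s); last exact: Tc.
rewrite Tb; case: ifPn => [/andP[nt tb]|_]; last exact: addr0.
rewrite [gamma_sum _ _ _ _ _ _]normal_zero ?addr0 // => h hRS.
have [rows norm _ _ _] := index_sets_rows (SM s).
have [_ hb] := rows h (subsetP (subsetUl _ _) _ hRS).
have := Tb h; rewrite norm // hb /=.
have -> : T h (jj s) = A h (jj s).
  move: hRS; rewrite in_setU => /orP[hR|hS]; last by rewrite TS ?vA.
  by rewrite (nrows_template TT mT hR) (nrows_template A_template (erefl _) hR).
by move/eqP; rewrite -[X in X == _]addr0 => /eqP/addrI.
Qed.

Local Notation Apow := (Avs theta J ii jj SS MM A).

Lemma Apow_VJ s v : Apow s v \in VJ F J.
Proof. by have [w [_ _]] := @Avs_spec A s v A_nt (erefl _) (refl_right s). Qed.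

Lemma Apow_rrel s v : rrel J A (Apow s v).
Proof.
have [w [Zb Zc ZV _ _]] := @Avs_spec A s v A_nt (erefl _) (refl_right s).
apply: (rrel_intro J_cc A_VJ ZV) => c; have [->|cs] := eqVneq c (jj s).
  by right; exists (ii s), w.
by left=> t; apply: Zc.
Qed.

Lemma y_UJ s v : y A s v \in UJ F J.
Proof. by have [] := @Astep_spec A s v A_nt (erefl _) (refl_right s). Qed.

Lemma Ws_lactm s v : v \in W s -> lactm J (y A s v) (Apow s v) = A.
Proof. exact: Ws_step. Qed.

Lemma Ws_lrel s v : v \in W s -> lrel J A (Apow s v).
Proof.
move=> vW; apply: (lrel_sym J_cc theta_char (Apow_VJ s v)).
by exists (y A s v); [exact: y_UJ|rewrite Ws_lactm].
Qed.

Local Notation lid := (lid theta J).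

Lemma Ws_lid s v : v \in W s -> lid (Apow s v) = lact (invmx (y A s v)) (lid A).
Proof.
move=> vW; have yU := y_UJ s v.
have := lact_lid theta J_cc (Apow_VJ s v) yU; rewrite Ws_lactm // => <-.
by rewrite lactK.
Qed.

(** Each factor sends $[A]$ to $[A^v]$ in the right orbit of $[A]$. As the actions commute, it maps
    that whole orbit to itself, and so does any product. *)
Lemma yprod_rrel (v : {ffun 'I_m -> {ffun 'I_n -> F}}) (l : seq 'I_m) :
  (forall s, v s \in W s) ->
  let u := \big[mulmx/1%:M]_(s <- l) invmx (y A s (v s)) in
  u \in UJ F J /\ lact u (lid A) \in orbr theta J A.
Proof.
move=> vW /=; elim: l => [|s l [uU uR]].
  by rewrite big_nil UJ1 lact1 lid_in_orbr.
have yU : invmx (y A s (v s)) \in UJ F J by rewrite (UJV J_cc) ?y_UJ.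
rewrite big_cons (UJM J_cc) //; split=> //.
rewrite -(lact_comp J_cc) //; case/orbrP: uR => g gU ->.
rewrite (lract_comm J_cc) // -Ws_lid //.
apply: (orbr_sub J_cc A_VJ (Apow_rrel s (v s))).
by apply/orbrP; exists g.
Qed.

Lemma mem_take_ord (k : nat) s : s \in take k (enum 'I_m) -> (s < k)%N.
Proof.
move=> /(map_f val); rewrite map_take val_enum_ord take_iota mem_iota add0n.
by move=> /andP[_ /leq_trans]; apply; exact: geq_minl.
Qed.

Lemma lactm_col u X Z c : (forall t, X t c = Z t c) ->
  forall t, lactm J u X t c = lactm J u Z t c.
Proof.
by move=> XZ t; rewrite !mxE; case: ifP => // _; apply: eq_bigr => k _; rewrite XZ.
Qed.

(* X - A vanishes in the normal rows, so its entries in the rows of M determine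
   the coefficients of the columns of \tilde A(a, b). *)
Lemma Ws_column X s : rrel J A X -> lrel J A X ->
  exists2 v, v \in W s & forall t, X t (jj s) = Apow s v t (jj s).
Proof.
move=> AXr AXl; have XV := rrel_VJ J_cc A_VJ AXr.
pose v := [ffun h => if h \in SS s then A h (jj s) else
  if h \in MM s then X h (jj s) else 0].
exists v; first exact: WsP_intro.
have [w [Zb _ ZV ZSM ZR]] :=
  @Avs_spec A s v A_nt (erefl _) (refl_right s).
have mX := lrel_mainc J_cc A_VJ AXl.
have X0 i : (i < ii s)%N -> X i (jj s) = 0.
  by apply: mainc_above; rewrite mX main_mem.
have [w' Xw'] := rrel_gamma J_cc A_VJ (template_rook A_template) AXr (main_mem s) X0.
have [inj _ _ _] := index_setsP J_cc A_nt (SM s).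
have [rows norm disj _ _] := index_sets_rows (SM s).
(* [X] and $A^v$ agree in all rows $\mathcal F$: zeros in [nrows], entries of [A] in [SS s], entries
   of [X] in [MM s]. *)
have ww' x : x \in main_Gamma J A (ii s) (jj s) -> w' x - w x = 0.
  apply: (inj (fun x => w' x - w x)) => t tFF; have [_ tb] := rows t tFF.
  have := gamma_sumB J A (ii s) (jj s) w' w t; rewrite /gamma_sum => ->.
  rewrite -!/(gamma_sum _ _ _ _ _ _); apply/eqP; rewrite subr_eq0.
  rewrite -(inj_eq (addrI (A t (jj s)))) -Zb // -Xw' //; apply/eqP.
  move: tFF; rewrite -setUA in_setU => /orP[tR|tSM].
    rewrite ZR // (lrel_fixed J_cc A_VJ AXl) ?norm ?in_setU ?tR //.
    exact: nrows_template A_template (erefl _) tR.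
  rewrite ZSM // ffunE; case: ifPn => [tS|tS].
    by rewrite (lrel_fixed J_cc A_VJ AXl) // norm // in_setU tS orbT.
  by move: tSM; rewrite in_setU (negPf tS) /= => ->.
move=> t; have [tb|bt] := ltnP t (jj s).
  rewrite Xw' // Zb //; congr (_ + _); apply: eq_bigr => x /ww'/eqP.
  by rewrite subr_eq0 => /eqP ->.
have tN : (t, jj s) \notin J by apply/negP => /(J_lt J_cc); rewrite ltnNge bt.
by rewrite (VJ0 XV tN) (VJ0 ZV tN).
Qed.

(** Induction on the number of columns that may still differ from [A]. In the last of these, [X]
    agrees with some $A^v$, so applying $y_v$ turns that column into the one of [A]; it also
    preserves the later columns, where [X], $A^v$ and [A] coincide. *)
Lemma inter_yprod (k : nat) X : (k <= m)%N -> rrel J A X -> lrel J A X ->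
  (forall s, (k <= s)%N -> forall t, X t (jj s) = A t (jj s)) ->
  exists v : {ffun 'I_m -> {ffun 'I_n -> F}}, (forall s, v s \in W s) /\
  lid X = lact (\big[mulmx/1%:M]_(s <- rev (take k (enum 'I_m)))
                  invmx (y A s (v s))) (lid A).
Proof.
elim: k X => [|k IH] X km AXr AXl XA.
  exists [ffun s => [ffun h => if h \in SS s then A h (jj s) else
    if h \in MM s then 0 else 0]].
  split=> [s|]; first by rewrite ffunE; apply: (WsP_intro s (fun=> 0)).
  rewrite take0 big_nil lact1; congr lid; apply/matrixP => t c.
  have [[s ->]|cN] := column_nonmain c; first exact: XA.
  by rewrite !nonmain_col // (lrel_mainc J_cc A_VJ AXl).
pose s := Ordinal km; have [v vW Xv] := Ws_column s AXr AXl.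
have XV := rrel_VJ J_cc A_VJ AXr.
set u := y A s v; have uU : u \in UJ F J := y_UJ s v.
have AuA : rrel J A (lactm J u A).
  apply: (rrel_sym J_cc theta_char); first exact: piJ_VJ.
  have := rrel_lactm J_cc theta_char uU A_VJ (Apow_rrel s v).
  by rewrite Ws_lactm.
have [||||v' [v'W v'E]] := IH (lactm J u X).
- exact: ltnW.
- apply: (rrel_trans J_cc theta_char A_VJ AuA).
  exact: (rrel_lactm J_cc theta_char uU A_VJ AXr).
- by apply: (lrel_trans J_cc theta_char A_VJ AXl); exists u.
(* The left action works column by column, so columns equal in [X] and $A^v$ both go to the column
   of [A]. *)
- move=> r kr t; apply: etrans (_ : lactm J u (Apow s v) t (jj r) = _); last first.
    by rewrite Ws_lactm.
  apply: lactm_col => {}t.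
  have [->|rs] := eqVneq r s; first exact: Xv.
  have lt : (s < r)%N by rewrite ltn_neqAle kr andbT eq_sym -val_eqE in rs *.
  rewrite XA //; have [w [_ -> //]] :=
    @Avs_spec A s v A_nt (erefl _) (refl_right s).
  by rewrite (inj_eq jj_inj).
exists [ffun r => if r == s then v else v' r]; split=> [r|].
  by rewrite ffunE; case: eqP => [->|].
have -> : take k.+1 (enum 'I_m) = rcons (take k (enum 'I_m)) s.
  by rewrite (take_nth s) ?size_enum_ord //; congr rcons; apply: (nth_ord_enum s s).
rewrite rev_rcons big_cons ffunE eqxx -/u.
(* Overriding the family at [s] does not affect the earlier factors, all of index below [k]. *)
have -> : \big[mulmx/1%:M]_(r <- rev (take k (enum 'I_m)))
    invmx (y A r ([ffun r => if r == s then v else v' r] r)) =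
  \big[mulmx/1%:M]_(r <- rev (take k (enum 'I_m))) invmx (y A r (v' r)).
  apply: eq_big_seq => r; rewrite mem_rev => /mem_take_ord rk.
  by rewrite ffunE -val_eqE ltn_eqF.
have [pU _] := yprod_rrel (rev (take k (enum 'I_m))) v'W.
by rewrite -(lact_comp J_cc) ?(UJV J_cc) // -v'E -lact_lid // lactK.
Qed.

End Iterates.

Theorem theorem6p22 (R : realType) (F : finFieldType) (n : nat)
  (theta : F -> R[i]) (theta_char : nontrivial_character theta)
  (J : {set 'I_n * 'I_n}) (J_cc : column_closed J)
  (A : 'M[F]_n) (A_nt : normal_template J A)
  (m : nat) (ii jj : 'I_m -> 'I_n)
  (main_A : mainc A = [set (ii s, jj s) | s : 'I_m])
  (jj_incr : forall s t : 'I_m, (s < t)%N -> (jj s < jj t)%N)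
  (SS MM : 'I_m -> {set 'I_n})
  (SM : forall s : 'I_m, index_sets J A (ii s) (jj s) (SS s) (MM s))
  (y : 'M[F]_n -> 'I_m -> {ffun 'I_n -> F} -> 'M[F]_n)
  (y_ok : y_choice theta J ii jj SS MM y) :
  let: Y := YpJ (mainc A) J in
  let: Apow := Avs theta J ii jj SS MM A in
  let: A1 := Astep theta J ii jj SS MM y A in
  let: Aseq := Aiter theta J ii jj SS MM y A in
  let: Sfam := [set v : {ffun 'I_m -> {ffun 'I_n -> F}} |
                  [forall s, v s \in vecs F (SS s)]] in
  let: W := Ws jj SS MM A in
  [/\ (forall v, v \in Sfam -> normal_template J (Aseq v)),
      (forall C : 'M[F]_n, template J C -> mainc C = mainc A ->
         (CU_iso <<orbr theta J C>>%VS <<orbr theta J A>>%VS <->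
          exists L v, [/\ L \in vecs F Y, v \in Sfam
            & lid theta J C = lid theta J (put Y L (Aseq v))]))
    & (forall chi : CV F R J, chi \in orbbi theta J A <->
         exists L v, [/\ L \in vecs F Y, v \in Sfam
            & chi \in orbr theta J (put Y L (Aseq v))]) /\
      (forall L L' v v' (chi : CV F R J),
         L \in vecs F Y -> L' \in vecs F Y -> v \in Sfam -> v' \in Sfam ->
         chi \in orbr theta J (put Y L (Aseq v)) ->
         chi \in orbr theta J (put Y L' (Aseq v')) -> L = L' /\ v = v')] /\
  (forall s v, v \in W s ->
     [/\ lid theta J (A1 s v) = lid theta J A,
         lid theta J (Apow s v) = lact (invmx (y A s v)) (lid theta J (A1 s v)),
         lid theta J (Apow s v) = lact (invmx (y A s v)) (lid theta J A),
         lid theta J (Apow s v) \in orbr theta J A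
       & lid theta J (Apow s v) \in orbl theta J A]) /\
  (forall chi : CV F R J,
     chi \in orbr theta J A /\ chi \in orbl theta J A <->
     exists v : {ffun 'I_m -> {ffun 'I_n -> F}},
       (forall s, v s \in W s) /\ chi = lact (yprod y A v) (lid theta J A)).
Proof.
move=> /=; have AV := A_VJ A_nt; have AT := A_template A_nt.
have famT L v := family_template J_cc theta_char A_nt main_A jj_incr SM y_ok L v.
have famin : forall C Z, template J C -> mainc C = mainc A -> lrel J A Z -> rrel J Z C ->
    exists L v, [/\ L \in vecs F (YpJ (mainc A) J),
      v \in [set v : {ffun 'I_m -> {ffun 'I_n -> F}} | [forall s, v s \in vecs F (SS s)]]
      & C = put (YpJ (mainc A) J) L (Aiter theta J ii jj SS MM y A v)].
  by move=> C Z; apply: (template_in_family J_cc theta_char A_nt main_A jj_incr SM y_ok).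
set Y := YpJ (mainc A) J in famT famin *.
set Sfam := [set v : {ffun 'I_m -> {ffun 'I_n -> F}} | _] in famin *.
set Aseq := Aiter theta J ii jj SS MM y A in famT famin *.
(* The biorbit is a union of right orbits of matrices [Z] in the left orbit of [A]; each contains a
   template with the main conditions of [A], which belongs to the family. *)
have bi chi : chi \in orbbi theta J A <-> exists L v, [/\ L \in vecs F Y, v \in Sfam
    & chi \in orbr theta J (put Y L (Aseq v))].
  split=> [/(orbbi_lr J_cc _ _ AV)[Z AZ chiZ]|[L [v [_ _ chiX]]]]; last first.
    have [_ _ [W AW WX]] := famT L v.
    exact: (orbbi_rl J_cc AV AW WX).
  have ZV := lrel_VJ J_cc AV AZ; have mZ := lrel_mainc J_cc AV AZ.
  have rZ : rook (mainc Z) by rewrite mZ; apply: template_rook AT.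
  have [C [CT mC ZC]] := rrel_reduce J_cc ZV rZ.
  have [|L [v [LY vS CE]]] := famin C Z CT _ AZ ZC; first by rewrite mC mZ.
  exists L, v; split=> //; rewrite -CE.
  by apply: (orbr_sub J_cc (template_VJ CT) (rrel_sym J_cc theta_char ZV ZC)).
have iso C : C \in VJ F J -> CU_iso <<orbr theta J C>>%VS <<orbr theta J A>>%VS <->
    lid theta J C \in orbbi theta J A.
  move=> CV0; split; first exact: CU_iso_orbbi.
  exact: orbbi_CU_iso.
split; [split|split].
- by move=> v _; have [] := Aiter_spec J_cc theta_char A_nt main_A jj_incr SM y_ok v.
- move=> C CT mC; have CV0 := template_VJ CT; rewrite iso // bi; split; last first.
    by case=> L [v [LY vS ->]]; exists L, v; split=> //; apply: lid_in_orbr.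
  case=> L [v [LY vS CX]]; exists L, v; split=> //; congr lid.
  have [XT mX _] := famT L v; have XV := template_VJ XT.
  apply: (rrel_template J_cc XT CT); first by rewrite mC mX.
  exact/(lid_orbr J_cc theta_char XV CV0).
- split=> // L L' v v' chi LY LY' vS vS' chiX chiX'.
  apply: (family_inj J_cc theta_char A_nt main_A jj_incr SM y_ok LY LY' vS vS').
  have [XT mX _] := famT L v; have XV := template_VJ XT.
  have [XT' mX' _] := famT L' v'; have XV' := template_VJ XT'.
  have [Z XZ chiZ] := orbr_rrel J_cc XV chiX.
  have ZV := rrel_VJ J_cc XV XZ.
  (* A common character puts both templates in one right orbit, where templates with equal main
     conditions coincide. *)
  have X'Z : rrel J (put Y L' (Aseq v')) Z.
    by apply/(lid_orbr J_cc theta_char XV' ZV); rewrite -chiZ.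
  apply: (rrel_template J_cc XT' XT); first by rewrite mX mX'.
  apply: (rrel_trans J_cc theta_char XV' X'Z).
  exact: (rrel_sym J_cc theta_char XV XZ).
- move=> s v vW; have A1 := Ws_step J_cc theta_char A_nt main_A SM y_ok vW.
  have e := Ws_lid J_cc theta_char A_nt main_A SM y_ok vW.
  have PV := Apow_VJ J_cc theta_char A_nt main_A SM s v.
  rewrite A1; split=> //.
    apply/(lid_orbr J_cc theta_char AV PV).
    exact: (Apow_rrel J_cc theta_char A_nt main_A SM s v).
  apply/(lid_orbl J_cc theta_char AV PV).
  exact: (Ws_lrel J_cc theta_char A_nt main_A SM y_ok vW).
- move=> chi; split=> [[chir chil]|[v [vW ->]]]; last first.
    have [uU uR] := yprod_rrel J_cc theta_char A_nt main_A SM y_ok (rev (enum 'I_m)) vW.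
    by split=> //; apply/orblP; exists (yprod y A v).
  have [X AXr chiX] := orbr_rrel J_cc AV chir; have XV := rrel_VJ J_cc AV AXr.
  have AXl : lrel J A X by apply/(lid_orbl J_cc theta_char AV XV); rewrite -chiX.
  (* At [k = m] no column has to agree with [A] beforehand. *)
  have [s|v [vW vE]] := inter_yprod J_cc theta_char A_nt main_A jj_incr SM y_ok
    (leqnn m) AXr AXl; first by rewrite leqNgt ltn_ord.
  exists v; split=> //; rewrite chiX vE /yprod take_oversize //.
  by rewrite size_enum_ord.
Qed.
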